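(* Let $R$ be a commutative ring and let $R[X_1,X_2,\dots,X_n]$ be the polynomial ring in $n$ indeterminates over $R$. Then $$\mathrm{G\text{-}gldim}(R[X_1,X_2,\dots,X_n])=\mathrm{G\text{-}gldim}(R)+n.$$
   Context: All rings are commutative with identity element and all modules are unital; no Noetherian hypothesis is made. An $R$-module $M$ is Gorenstein projective if there is an exact sequence of projective $R$-modules $\mathbf{P}=\cdots\to P_1\to P_0\to P^0\to P^1\to\cdots$ such that $M\cong \mathrm{Im}(P_0\to P^0)$ and such that $\mathrm{Hom}_R(-,Q)$ leaves $\mathbf{P}$ exact for every projective $R$-module $Q$. The Gorenstein projective dimension $\mathrm{Gpd}_R(M)$ of an $R$-module $M$ is the least integer $k\geq 0$ such that there is an exact sequence $0\to G_k\to\cdots\to G_0\to M\to 0$ with all $G_i$ Gorenstein projective, and $\infty$ if no such $k$ exists. The Gorenstein global dimension of $R$ is $\mathrm{G\text{-}gldim}(R)=\sup\{\mathrm{Gpd}_R(M)\mid M \text{ an } R\text{-module}\}$, which may be $\infty$ (with $\infty+n=\infty$). (It is known that this equals the supremum of the Gorenstein injective dimensions of all $R$-modules.) *)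

(* Defs.v *)
From HB Require Import structures.
From mathcomp Require Import all_boot all_order all_algebra.
From mathcomp Require Import boolp.
From mathcomp Require Import mpoly.

Set Implicit Arguments.
Unset Strict Implicit.
Unset Printing Implicit Defensive.

Import GRing.Theory.
Local Open Scope ring_scope.

(* Extended natural numbers: [Some k] is the integer k, [None] is infinity. *)
Definition enat := option nat.

Definition enat_le (a b : enat) : Prop :=
  match a, b with
  | _, None => True
  | None, Some _ => False
  | Some m, Some n => (m <= n)%N
  end.

Definition enat_addn (a : enat) (n : nat) : enat := omap (addn^~ n) a.

Lemma least_bool (P : nat -> Prop) :
  (exists k, P k) -> exists k, (fun k => `[< P k >]) k.
Proof. by case=> k Pk; exists k; apply/asboolP. Qed.

Definition least (P : nat -> Prop) : enat :=
  match pselect (exists k, P k) with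
  | left exP => Some (ex_minn (least_bool exP))
  | right _ => None
  end.

(* A subset of the extended natural numbers without a finite upper bound has
   supremum infinity, so the least finite upper bound, if any, is the sup. *)
Definition enat_sup (S : enat -> Prop) : enat :=
  least (fun k => forall a, S a -> enat_le a (Some k)).

Section Modules.
Variable R : comNzRingType.

Definition exact_at (A B C : lmodType R)
    (f : {linear A -> B}) (g : {linear B -> C}) : Prop :=
  forall y : B, g y = 0 <-> exists x : A, f x = y.

(* Exactness of Hom(C, Q) -> Hom(B, Q) -> Hom(A, Q) at the middle term. *)
Definition hom_exact_at (Q A B C : lmodType R)
    (f : {linear A -> B}) (g : {linear B -> C}) : Prop :=
  forall u : {linear B -> Q},
    (forall x : A, u (f x) = 0) <->
    exists v : {linear C -> Q}, forall y : B, v (g y) = u y.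

Definition projective (P : lmodType R) : Prop :=
  forall (A B : lmodType R) (g : {linear A -> B}) (f : {linear P -> B}),
    (forall b : B, exists a : A, g a = b) ->
    exists h : {linear P -> A}, forall x : P, g (h x) = f x.

(* Doubly infinite sequences
     ... -> dn 1 -> dn 0 -> up 0 -> up 1 -> ...,
   where dn i is the module P_i and up i is the module P^i. *)
Record biseq := Biseq {
  dn : nat -> lmodType R;
  up : nat -> lmodType R;
  dn_map : forall i, {linear dn i.+1 -> dn i};
  mid_map : {linear dn 0%N -> up 0%N};
  up_map : forall i, {linear up i -> up i.+1} }.

Definition everywhere
    (E : forall A B C : lmodType R,
       {linear A -> B} -> {linear B -> C} -> Prop) (P : biseq) : Prop :=
  [/\ forall i, E _ _ _ (dn_map P i.+1) (dn_map P i),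
      E _ _ _ (dn_map P 0%N) (mid_map P),
      E _ _ _ (mid_map P) (up_map P 0%N) &
      forall i, E _ _ _ (up_map P i) (up_map P i.+1)].

(* The isomorphism of M with the image of P_0 -> P^0 is given as an injective
   linear map j into P^0 having that image. *)
Definition Gorenstein_projective (M : lmodType R) : Prop :=
  exists P : biseq,
    [/\ forall i, projective (dn P i) /\ projective (up P i),
        everywhere exact_at P,
        forall Q : lmodType R, projective Q -> everywhere (@hom_exact_at Q) P &
        exists j : {linear M -> up P 0%N},
          injective j /\
          forall y, (exists m, j m = y) <-> (exists x, mid_map P x = y)].

(* Existence of an exact sequence 0 -> G_k -> ... -> G_0 -> M -> 0 with
   Gorenstein projective terms, extended by G_i = 0 for i > k. *)
Definition Gproj_resolution (M : lmodType R) (k : nat) : Prop :=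
  exists (G : nat -> lmodType R) (d : forall i, {linear G i.+1 -> G i})
      (e : {linear G 0%N -> M}),
    [/\ forall i, (i <= k)%N -> Gorenstein_projective (G i),
        forall i, (k < i)%N -> forall x : G i, x = 0,
        forall m : M, exists x, e x = m,
        exact_at (d 0%N) e &
        forall i, exact_at (d i.+1) (d i)].

Definition Gpd (M : lmodType R) : enat := least (Gproj_resolution M).

End Modules.

Definition G_gldim (R : comNzRingType) : enat :=
  enat_sup (fun a => exists M : lmodType R, a = Gpd M).

(* Main.v *)
(* The condition G-gldim R <= n is equivalent to
   (a) every R-module embeds in a module of finite projective dimension, and
   (b) Ext^(n+1)(M, Q) = 0 for every module M and every projective Q.
   If every module has a Gorenstein projective resolution of length <= n, then
   (b) is dimension shifting, and pushing out along a resolution embeds M in a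
   module H of finite projective dimension with Gorenstein projective cokernel.
   Conversely, embed M in H as in (a) and take n-th syzygies: that of H is
   projective, because it has finite projective dimension and no Ext into
   projectives, so an n-th syzygy embeds in a projective module with cokernel
   again an n-th syzygy.  Iterating, every n-th syzygy is Gorenstein projective.

   Both conditions pass between R (with n) and R[X] (with n + 1).  Upwards one
   uses 0 -> N[X] -> N[X] -> N -> 0 for an R[X]-module N; downwards one restricts
   scalars for (a), and for (b) regards an R-module as an R[X]-module killed by
   X, as in Rees' change of rings theorem. *)
Require Import Defs.
From HB Require Import structures.
From mathcomp Require Import all_boot all_order all_algebra.
From mathcomp Require Import generic_quotient ring_quotient boolp.
From mathcomp Require Import finmap mpoly.
From mathcomp Require monalg.

Set Implicit Arguments.
Unset Strict Implicit.
Unset Printing Implicit Defensive.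

Import GRing.Theory.
Local Open Scope ring_scope.
Local Open Scope quotient_scope.

(** * Submodules, quotients and short exact sequences *)

Section Constructions.
Variable R : comNzRingType.
Implicit Types A B C D E K L M N P Q Z : lmodType R.

(** Going up, condition (a) is the delicate one. An R[X]-module N is the cokernel of an injective
    map N[X] -> N[X], and a hull of N[X] says nothing directly about a quotient of it. Embedding the
    restriction of N in H embeds N[X] in H[X], and the map N[X] -> N[X] is to be extended to H[X] ->
    H[X]. This needs Ext^1(G[X], H[X]) = 0 for G the cokernel of N -> H, so the hull is used in its
    stronger form, with G Gorenstein projective. The extended map may fail to be injective; mapping
    H[X] also to a projective P[X] that contains G[X] repairs this, and N embeds in the cokernel of
    H[X] -> H[X] + P[X].

    The passage between the rings compares the bounds n and n + 1, so the bound 0 over R[X] is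
    excluded separately, by the multiplication by X on R[X], which does not split.

    Ext is never built as a group: its vanishing means that maps extend along monomorphisms, and
    higher degrees are reached through syzygies. The required pieces of the long exact sequences are
    proved one by one. *)

Lemma mklin A B (f : A -> B) : linear f -> exists g : {linear A -> B}, g =1 f.
Proof.
by move=> lf; exists (HB.pack_for {linear A -> B} f (GRing.isLinear.Build R A B *:%R f lf)).
Qed.

(** Membership lives in [Prop]; [submod_pred] makes it boolean classically, so that the generic
    substructures and quotients apply to kernels and images. *)
Record submod B := Submod {
  submod_mem :> B -> Prop;
  submod0 : submod_mem 0;
  submodP : forall a x y, submod_mem x -> submod_mem y -> submod_mem (a *: x + y) }.

Definition submod_pred B (U : submod B) : {pred B} := fun x => `[< U x >].

Lemma submod_predE B (U : submod B) x : (x \in submod_pred U) = `[< U x >].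
Proof. by []. Qed.

Lemma submod_pred_closed B (U : submod B) : submod_closed (submod_pred U).
Proof.
split=> [|a x y]; first exact/asboolP/submod0.
by rewrite !submod_predE => /asboolP Ux /asboolP Uy; apply/asboolP/submodP.
Qed.

HB.instance Definition _ B (U : submod B) :=
  GRing.isSubmodClosed.Build R B (submod_pred U) (submod_pred_closed U).

Record subm B (U : submod B) :=
  Subm { subm_val : B; subm_valP : subm_val \in submod_pred U }.

HB.instance Definition _ B (U : submod B) := [isSub for @subm_val B U].
HB.instance Definition _ B (U : submod B) := [Choice of subm U by <:].
HB.instance Definition _ B (U : submod B) :=
  [SubChoice_isSubLmodule of subm U by <:].

Definition quotm B (U : submod B) := Quotient.quot (submod_pred U).
HB.instance Definition _ B (U : submod B) := GRing.Zmodule.on (quotm U).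

Section Quot.
Variables (B : lmodType R) (U : submod B).
Let p : B -> quotm U := \pi_(Quotient.quot (submod_pred U)).

Let p_eq x y : p x = p y <-> U (x - y).
Proof.
split=> [/eqP|Uxy].
  by rewrite /p -(Quotient.idealrBE (submod_pred U)) submod_predE => /asboolP.
by apply/eqP; rewrite /p -(Quotient.idealrBE (submod_pred U)); apply/asboolP.
Qed.

Let p_surj y : exists x, p x = y.
Proof. by exists (repr y); rewrite /p reprK. Qed.

Let pD x y : p (x + y) = p x + p y.
Proof. by rewrite /p raddfD. Qed.

Definition quotm_scale (a : R) (x : quotm U) : quotm U := p (a *: repr x).

Let p_scale a x : quotm_scale a (p x) = p (a *: x).
Proof.
apply/p_eq; rewrite -scalerBr -[_ *: _]addr0; apply: submodP; last exact: submod0.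
by apply/p_eq; rewrite /p reprK.
Qed.

Lemma quotm_scaleA a b v : quotm_scale a (quotm_scale b v) = quotm_scale (a * b) v.
Proof. by case: (p_surj v) => x <-; rewrite !p_scale scalerA. Qed.
Lemma quotm_scale1 : left_id 1 quotm_scale.
Proof. by move=> v; case: (p_surj v) => x <-; rewrite p_scale scale1r. Qed.
Lemma quotm_scaleDr : right_distributive quotm_scale +%R.
Proof.
move=> a u v; case: (p_surj u) (p_surj v) => x <- [y <-].
by rewrite -pD !p_scale scalerDr pD.
Qed.
Lemma quotm_scaleDl v : {morph quotm_scale^~ v : a b / a + b}.
Proof. by move=> a b; case: (p_surj v) => x <-; rewrite !p_scale scalerDl pD. Qed.

HB.instance Definition _ := GRing.Zmodule_isLmodule.Build R (quotm U)
  quotm_scaleA quotm_scale1 quotm_scaleDr quotm_scaleDl.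

Lemma quotm_ex : exists q : {linear B -> quotm U},
  (forall y, exists x, q x = y) /\ forall x, q x = 0 <-> U x.
Proof.
have [|q qE] := @mklin B (quotm U) p.
  by move=> a x y; rewrite pD -p_scale.
exists q; split=> [y|x]; first by have [x <-] := p_surj y; exists x.
by have := p_eq x 0; rewrite subr0 -!qE linear0.
Qed.
End Quot.

Definition ses A B C (i : {linear A -> B}) (p : {linear B -> C}) : Prop :=
  [/\ injective i, forall c, exists b, p b = c & exact_at i p].

Lemma ses0 A B C (i : {linear A -> B}) (p : {linear B -> C}) :
  ses i p -> forall x, p (i x) = 0.
Proof. by case=> _ _ ex x; apply/ex; exists x. Qed.

Lemma ses_lift A B C (i : {linear A -> B}) (p : {linear B -> C}) :
  ses i p -> forall y, p y = 0 -> exists x, i x = y.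
Proof. by case=> _ _ ex y /ex. Qed.

Lemma inj_ker A B (f : {linear A -> B}) :
  (forall x, f x = 0 -> x = 0) -> injective f.
Proof.
by move=> f0 x y fxy; apply/eqP; rewrite -subr_eq0; apply/eqP/f0;
   rewrite linearB fxy subrr.
Qed.

Lemma surj_section (S T : Type) (p : S -> T) :
  (forall y, exists x, p x = y) -> exists s, cancel s p.
Proof. by move=> sp; exists (fun y => sval (cid (sp y))) => y; case: cid. Qed.

(** The section [s] is a mere function, but [u] does not see which preimage is chosen, so [u \o s]
    is linear. *)
Lemma factor_surj B C D (p : {linear B -> C}) (u : {linear B -> D}) :
  (forall c, exists b, p b = c) -> (forall b, p b = 0 -> u b = 0) ->
  exists v : {linear C -> D}, forall b, v (p b) = u b.
Proof.
move=> /surj_section[s sK] pu.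
have us b : u (s (p b)) = u b.
  by apply/eqP; rewrite -subr_eq0 -linearB; apply/eqP/pu; rewrite linearB sK subrr.
have [|v vE] := @mklin C D (u \o s); last by exists v => b; rewrite vE /= us.
by move=> a x y /=; rewrite -linearP -[RHS]us linearP !sK.
Qed.

Lemma factor_inj A B D (i : {linear A -> B}) (u : {linear D -> B}) :
  injective i -> (forall d, exists a, i a = u d) ->
  exists v : {linear D -> A}, forall d, i (v d) = u d.
Proof.
move=> inj_i iu; pose s d := sval (cid (iu d)).
have sE d : i (s d) = u d by rewrite /s; case: cid.
have [|v vE] := @mklin D A s; last by exists v => d; rewrite vE.
by move=> a x y; apply: inj_i; rewrite linearP !sE linearP.
Qed.

Lemma subm_ex B (U : submod B) : exists i : {linear subm U -> B},
  injective i /\ forall y, U y <-> exists x, i x = y.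
Proof.
have [|i iE] := @mklin (subm U) B val; first by move=> a x y; rewrite linearP.
exists i; split=> [x y|y]; first by rewrite !iE => /val_inj.
split=> [/asboolP Uy|[x <-]]; first by exists (Subm Uy); rewrite iE.
by rewrite iE; apply/asboolP/(valP x).
Qed.

Lemma ker_submod B C (f : {linear B -> C}) : exists U : submod B,
  forall x, U x <-> f x = 0.
Proof.
have h a x y : f x = 0 -> f y = 0 -> f (a *: x + y) = 0.
  by move=> fx fy; rewrite linearP fx fy scaler0 addr0.
by exists (@Submod B (fun x => f x = 0) (linear0 f) h).
Qed.

Lemma im_submod A B (f : {linear A -> B}) : exists U : submod B,
  forall y, U y <-> exists x, f x = y.
Proof.
have h0 : exists x, f x = 0 by exists 0; rewrite linear0.
have h a x y : (exists u, f u = x) -> (exists u, f u = y) ->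
  exists u, f u = a *: x + y.
  by move=> [u <-] [v <-]; exists (a *: u + v); rewrite linearP.
by exists (@Submod B (fun y => exists x, f x = y) h0 h).
Qed.

Lemma ker_ex B C (p : {linear B -> C}) : exists A (i : {linear A -> B}),
  injective i /\ exact_at i p.
Proof.
have [U UE] := ker_submod p; have [i [inj_i iE]] := subm_ex U.
exists (subm U), i; split=> // y.
by split=> [/UE/iE //|/iE/UE].
Qed.

Lemma ses_ker B C (p : {linear B -> C}) :
  (forall c, exists b, p b = c) -> exists A (i : {linear A -> B}), ses i p.
Proof. by move=> sp; have [A [i [inj_i ex_i]]] := ker_ex p; exists A, i. Qed.

Lemma coker_ex A B (f : {linear A -> B}) : exists C (p : {linear B -> C}),
  (forall c, exists b, p b = c) /\ exact_at f p.
Proof.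
have [U UE] := im_submod f; have [q [sq qE]] := quotm_ex U.
exists (quotm U), q; split=> // y.
by split=> [/qE/UE //|/UE/qE].
Qed.

Lemma ses_coker A B (i : {linear A -> B}) :
  injective i -> exists C (p : {linear B -> C}), ses i p.
Proof. by move=> inj_i; have [C [p [sp ep]]] := coker_ex i; exists C, p. Qed.

Lemma prod_lin A B : 
  exists (f : {linear (A * B)%type -> A}) (g : {linear (A * B)%type -> B})
    (i : {linear A -> (A * B)%type}) (j : {linear B -> (A * B)%type}),
  [/\ forall x, f x = x.1, forall x, g x = x.2,
      forall a, i a = (a, 0) & forall b, j b = (0, b)].
Proof.
have [|f fE] := @mklin (A * B)%type A fst; first by [].
have [|g gE] := @mklin (A * B)%type B snd; first by [].
have [|i iE] := @mklin A (A * B)%type (fun a => (a, 0)).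
  by move=> a x y; congr (_, _); rewrite /= scaler0 addr0.
have [|j jE] := @mklin B (A * B)%type (fun b => (0, b)).
  by move=> a x y; congr (_, _); rewrite /= scaler0 addr0.
by exists f, g, i, j.
Qed.

Lemma prod_out A B C (f : {linear A -> C}) (g : {linear B -> C}) :
  exists h : {linear (A * B)%type -> C}, forall x, h x = f x.1 + g x.2.
Proof.
have [pa [pb [_ [_ [pE qE _ _]]]]] := prod_lin A B.
by exists ((f \o pa) \+ (g \o pb)) => x; rewrite /= pE qE.
Qed.

Lemma prod_in A B D (f : {linear D -> A}) (g : {linear D -> B}) :
  exists h : {linear D -> (A * B)%type}, forall x, h x = (f x, g x).
Proof.
by apply: mklin => a x y; rewrite !linearP.
Qed.

Lemma pullback A B C (f : {linear A -> C}) (g : {linear B -> C}) :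
  exists Z (a : {linear Z -> A}) (b : {linear Z -> B}),
  [/\ forall z, f (a z) = g (b z),
      forall z, a z = 0 -> b z = 0 -> z = 0
    & forall x y, f x = g y -> exists z, a z = x /\ b z = y].
Proof.
have [pa [pb [_ [_ [pE qE _ _]]]]] := prod_lin A B.
have [h hE] := prod_out f (\- g); have [Z [i [inj_i ex_i]]] := ker_ex h.
have i0 z : h (i z) = 0 by apply/ex_i; exists z.
exists Z, (pa \o i), (pb \o i); split=> [z|z|x y] /=; rewrite ?pE ?qE.
- by apply/eqP; rewrite -subr_eq0 -(i0 z) hE.
- move=> z1 z2; apply: inj_i; rewrite linear0.
  by case: (i z) z1 z2 => ? ? /= -> ->.
- move=> fg; have [z zE] : exists z, i z = (x, y).
    by apply/ex_i; rewrite hE /= fg subrr.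
  by exists z; rewrite pE qE zE.
Qed.

(** The cokernel of z |-> (f z, - g z), described by elements: the second clause says that only the
    forced identifications take place. *)
Lemma pushout A B C (f : {linear A -> B}) (g : {linear A -> C}) :
  exists E (a : {linear B -> E}) (b : {linear C -> E}),
  [/\ forall z, a (f z) = b (g z),
      forall x y, a x = b y -> exists z, f z = x /\ g z = y
    & forall e, exists x y, e = a x + b y].
Proof.
have [_ [_ [ia [ib [_ _ pE qE]]]]] := prod_lin B C.
have [h hE] := prod_in f (\- g); have [E [p [sp ep]]] := coker_ex h.
exists E, (p \o ia), (p \o ib); split=> [z|x y|e] /=; rewrite ?pE ?qE.
- apply/eqP; rewrite -subr_eq0 -linearB; apply/eqP/ep; exists z.
  by rewrite hE; congr (_, _); rewrite /= ?subr0 ?sub0r.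
- move/eqP; rewrite -subr_eq0 -linearB => /eqP/ep[z]; rewrite hE => e.
  exists z; move: (congr1 fst e) (congr1 snd e) => /=.
  by rewrite subr0 sub0r => -> /oppr_inj ->.
- have [[x y] <-] := sp e; exists x, y; rewrite pE qE -linearD.
  by congr (p (_, _)); rewrite /= ?addr0 ?add0r.
Qed.

End Constructions.

(** * Direct sums *)

Module DirectSum.
Section DirectSum.
Import monalg.
Variable R : comNzRingType.
Variables (T : choiceType) (M : lmodType R).

(** Used twice: with [M] the ring, for free modules, and with [T] the natural numbers, for M[X]. *)
Definition dsum : Type := monalg.malg T M.
HB.instance Definition _ := GRing.Zmodule.on dsum.

Local Notation cf := monalg.mcoeff.
Implicit Types (g : dsum) (t : T) (a : R).

Definition dsum_scale a g : dsum :=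
  \sum_(t <- monalg.msupp g) monalg.mkmalgU t (a *: cf t g).

Lemma dsum_scaleE a g t : cf t (dsum_scale a g) = a *: cf t g.
Proof.
rewrite /dsum_scale [X in _ = _ *: cf t X]monalg.monalgE !raddf_sum /=.
by apply/eq_bigr=> /= i _; rewrite !monalg.mcoeffU scalerMnr.
Qed.

Lemma dsum_scaleA a b g : dsum_scale a (dsum_scale b g) = dsum_scale (a * b) g.
Proof. by apply/monalg.malgP=> t; rewrite !dsum_scaleE scalerA. Qed.

Lemma dsum_scale1 : left_id 1 dsum_scale.
Proof. by move=> g; apply/monalg.malgP=> t; rewrite !dsum_scaleE scale1r. Qed.

Lemma dsum_scaleDr : right_distributive dsum_scale +%R.
Proof.
by move=> a g h; apply/monalg.malgP=> t;
   rewrite !(monalg.mcoeffD, dsum_scaleE) scalerDr.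
Qed.

Lemma dsum_scaleDl g : {morph dsum_scale^~ g : a b / a + b}.
Proof.
by move=> a b; apply/monalg.malgP=> t;
   rewrite !(monalg.mcoeffD, dsum_scaleE) scalerDl.
Qed.

HB.instance Definition _ := GRing.Zmodule_isLmodule.Build R dsum
  dsum_scaleA dsum_scale1 dsum_scaleDr dsum_scaleDl.

Definition dcoef t (g : dsum) : M := cf t g.

Lemma dcoef_linear t : linear (dcoef t).
Proof. by move=> a g h; rewrite /dcoef monalg.mcoeffD dsum_scaleE. Qed.

HB.instance Definition _ t :=
  GRing.isLinear.Build R dsum M *:%R (dcoef t) (dcoef_linear t).

Lemma dsum_ext g h : (forall t, dcoef t g = dcoef t h) -> g = h.
Proof. by move=> gh; apply/monalg.malgP. Qed.

Definition dinj t (x : M) : dsum := monalg.mkmalgU t x.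

Lemma dcoef_inj t t' x : dcoef t' (dinj t x) = x *+ (t == t').
Proof. exact: monalg.mcoeffU. Qed.

Lemma dinj_linear t : linear (dinj t).
Proof.
move=> a x y; apply: dsum_ext => t'; rewrite linearP /= !dcoef_inj.
by rewrite mulrnDl scalerMnr.
Qed.

HB.instance Definition _ t :=
  GRing.isLinear.Build R M dsum *:%R (dinj t) (dinj_linear t).

Lemma dsum_bound g : exists s : seq T, forall t, t \notin s -> dcoef t g = 0.
Proof. by exists (monalg.msupp g) => t /monalg.mcoeff_outdom. Qed.

Lemma dsum_ind (P : dsum -> Prop) :
  P 0 -> (forall g h, P g -> P h -> P (g + h)) -> (forall t x, P (dinj t x)) ->
  forall g, P g.
Proof. by move=> P0 PD PU g; rewrite [g]monalg.monalgE; elim/big_ind: _. Qed.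

Lemma dsum_out (N : lmodType R) (u : T -> {linear M -> N}) :
  exists h : {linear dsum -> N}, forall t x, h (dinj t x) = u t x.
Proof.
pose h (g : dsum) : N := \sum_(t <- monalg.msupp g) u t (cf t g).
have hE (d : {fset T}) g : fsubset (monalg.msupp g) d ->
    h g = \sum_(t <- d) u t (cf t g).
  move=> le; rewrite [LHS](big_fset_incl _ le) => //= t td.
  by move=> /monalg.mcoeff_outdom ->; rewrite linear0.
have [|f fE] := @mklin R dsum N h.
  move=> a g g' /=.
  (* The three supports differ, so all sums are taken over one finite set containing them. *)
  set e := fsetU (monalg.msupp g') (monalg.msupp (a *: g + g')).
  set d := fsetU (monalg.msupp g) e.
  have d1 : fsubset (monalg.msupp g) d by exact: fsubsetUl.
  have ed : fsubset e d by exact: fsubsetUr.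
  have d2 : fsubset (monalg.msupp g') d by apply: fsubset_trans (fsubsetUl _ _) ed.
  have d3 : fsubset (monalg.msupp (a *: g + g')) d.
    by apply: fsubset_trans (fsubsetUr _ _) ed.
  rewrite (hE _ _ d1) (hE _ _ d2) (hE _ _ d3).
  rewrite scaler_sumr -big_split /=; apply: eq_bigr => t _; rewrite -linearP.
  by congr (u t _); exact: dcoef_linear.
exists f => t x; rewrite fE (hE [fset t]%fset) ?monalg.msuppU_le //.
by rewrite big_seq_fset1 monalg.mcoeffUU.
Qed.
End DirectSum.
End DirectSum.
Import DirectSum.

(** * Projective dimension and vanishing of Ext *)

Section Homological.
Variable R : comNzRingType.
Implicit Types A B C D E K L M N P Q Z F : lmodType R.

Lemma proj_retract P Q (s : {linear Q -> P}) (r : {linear P -> Q}) :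
  cancel s r -> projective P -> projective Q.
Proof.
move=> sK pP A B g f sg; have [h hE] := pP A B g (f \o r) sg.
by exists (h \o s) => x /=; rewrite hE /= sK.
Qed.

Lemma proj_dsum (T : choiceType) M : projective M -> projective (dsum T M).
Proof.
move=> pM A B g f sg.
have [h hE] : exists h : T -> {linear M -> A}, forall t x, g (h t x) = f (dinj t x).
  have ex t : exists h : {linear M -> A}, forall x, g (h x) = f (dinj t x).
    by have [h hE] := pM A B g (f \o dinj t) sg; exists h.
  by exists (fun t => sval (cid (ex t))) => t; case: cid.
have [k kE] := dsum_out h; exists k.
by apply: dsum_ind => [|x y IHx IHy|t x]; rewrite ?linear0 ?linearD ?IHx ?IHy ?kE.
Qed.

Lemma regular_out A a : exists f : {linear R^o -> A}, forall x : R, f x = x *: a.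
Proof. by apply: mklin => c x y; rewrite scalerDl scalerA. Qed.

Lemma proj_regular : projective (R^o : lmodType R).
Proof.
move=> A B g f sg; have [a ga] := sg (f 1).
have [h hE] := regular_out a; exists h => x.
by rewrite hE linearZ /= ga -linearZ /= -[_ *: _]/(_ * _) mulr1.
Qed.

Lemma proj_cover M : exists P (p : {linear P -> M}),
  projective P /\ forall m, exists x, p x = m.
Proof.
pose u (m : M) := sval (cid (regular_out m)).
have [p pE] := dsum_out u; exists (dsum M R^o), p.
split=> [|m]; first exact/proj_dsum/proj_regular.
by exists (dinj m 1); rewrite pE /u; case: cid => f /= ->; rewrite scale1r.
Qed.

Definition SES A B C := exists (i : {linear A -> B}) (p : {linear B -> C}), ses i p.

Lemma pres_ex M : exists K P, SES K P M /\ projective P.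
Proof.
have [P [p [pP sp]]] := proj_cover M; have [K [i s]] := ses_ker sp.
by exists K, P; split=> //; exists i, p.
Qed.

Lemma ses_retraction A B C (i : {linear A -> B}) (p : {linear B -> C})
    (s : {linear C -> B}) : ses i p -> cancel s p ->
  exists r : {linear B -> A}, cancel i r /\ forall b, b = i (r b) + s (p b).
Proof.
move=> S sK; have [inj_i _ _] := S.
have [|r rE] := factor_inj (u := idfun \- (s \o p)) inj_i.
  by move=> d; apply: (ses_lift S); rewrite /= linearB sK subrr.
exists r; split=> [a|b]; last by rewrite rE /= subrK.
by apply: inj_i; rewrite rE /= (ses0 S) linear0 subr0.
Qed.

Lemma ses_split A B P (i : {linear A -> B}) (p : {linear B -> P}) :
  ses i p -> projective P -> exists (s : {linear P -> B}) (r : {linear B -> A}),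
  [/\ cancel s p, cancel i r & forall b, b = i (r b) + s (p b)].
Proof.
move=> S pP; have [s sE] := pP _ _ p idfun (let: And3 _ sp _ := S in sp).
by have [r [ir bE]] := ses_retraction S sE; exists s, r.
Qed.

Lemma proj_prod P Q : projective P -> projective Q -> projective (P * Q)%type.
Proof.
move=> pP pQ A B g f sg.
have [_ [_ [i [j [_ _ iE jE]]]]] := prod_lin P Q.
have [h hE] := pP _ _ g (f \o i) sg; have [k kE] := pQ _ _ g (f \o j) sg.
have [l lE] := prod_out h k; exists l => x.
rewrite lE linearD hE kE /= iE jE -linearD.
by case: x => x y; congr (f (_, _)); rewrite /= ?addr0 ?add0r.
Qed.

Lemma proj_ext A B C : SES A B C -> projective A -> projective C -> projective B.
Proof.
move=> [i [p S]] pA pC; have [s [r [sK iK bE]]] := ses_split S pC.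
have [f fE] := prod_in r p; have [g gE] := prod_out i s.
by apply: (proj_retract (s := f) (r := g)) (proj_prod pA pC) => b; rewrite fE gE.
Qed.

Lemma proj_ker A B P : SES A B P -> projective B -> projective P -> projective A.
Proof.
move=> [i [p S]] pB pP; have [s [r [_ iK _]]] := ses_split S pP.
exact: proj_retract iK pB.
Qed.

(* Ext^1(M, Q) = 0, expressed on all the extensions of M. *)
Definition E1 M Q := forall A B (i : {linear A -> B}) (p : {linear B -> M}),
  ses i p -> forall u : {linear A -> Q},
  exists v : {linear B -> Q}, forall a, v (i a) = u a.

(** One projective presentation suffices. Lift P -> M to [h : P -> B], restricting to [k : K -> A],
    and extend [u \o k] to P. Since B is a quotient of A x P, this extension and [u] glue to a map
    on B. *)
Lemma E1_pres K P M Q (i : {linear K -> P}) (p : {linear P -> M}) :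
  ses i p -> projective P ->
  (forall u : {linear K -> Q}, exists v : {linear P -> Q}, forall x, v (i x) = u x) ->
  E1 M Q.
Proof.
move=> S pP ext A B j q T u.
have [inj_j sq _] := T.
have [h hE] := pP _ _ q p sq.
have [|k kE] := factor_inj (u := h \o i) inj_j.
  by move=> d; apply: (ses_lift T); rewrite /= hE (ses0 S).
have [w wE] := ext (u \o k).
have [f fE] := prod_out j h; have [g gE] := prod_out u w.
have [||v vE] := @factor_surj _ _ _ _ f g.
- move=> b; have [_ sp _] := S; have [x xE] := sp (q b).
  have [|a aE] := ses_lift T (y := b - h x).
    by rewrite linearB hE xE subrr.
  by exists (a, x); rewrite fE /= aE subrK.
- move=> [a x]; rewrite fE gE /= => fx.
  have [|z zE] := ses_lift S (y := x).
    by rewrite -hE -[h x](addKr (j a)) fx addr0 linearN (ses0 T) oppr0.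
  have -> : a = - k z.
    by apply: inj_j; rewrite linearN kE /= zE; apply/eqP; rewrite -addr_eq0 fx.
  by rewrite -zE wE /= linearN addNr.
exists v => a; have := vE (a, 0); rewrite fE gE /= !linear0 !addr0 //.
Qed.

Lemma E1_proj P Q : projective P -> E1 P Q.
Proof.
move=> pP A B i p S u; have [s [r [_ iK _]]] := ses_split S pP.
by exists (u \o r) => a /=; rewrite iK.
Qed.

(** [Z] is the preimage of [A] in [F]. The last clause records that [K] sits in [Z] as it sits in
    [F], so that maps can be extended in two stages. *)
Lemma ker_comp A B C K F (i : {linear A -> B}) (p : {linear B -> C})
    (k : {linear K -> F}) (q : {linear F -> B}) : ses i p -> ses k q ->
  exists Z (k' : {linear K -> Z}) (q' : {linear Z -> A}) (z : {linear Z -> F}),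
  [/\ ses k' q', ses z (p \o q) & forall x, z (k' x) = k x].
Proof.
move=> S T; have [inj_i sp _] := S; have [inj_k sq _] := T.
have [c|Z [z U]] := @ses_ker _ _ _ (p \o q).
  by have [b <-] := sp c; have [x <-] := sq b; exists x.
have [inj_z _ _] := U.
have [|q' q'E] := factor_inj (u := q \o z) inj_i.
  by move=> d; apply: (ses_lift S); exact: (ses0 U d).
have [|k' k'E] := factor_inj (u := k) inj_z.
  by move=> d; apply: (ses_lift U); rewrite /= (ses0 T) linear0.
exists Z, k', q', z; split=> //; split.
- by move=> x y /(congr1 z); rewrite !k'E => /inj_k.
- move=> a; have [f fE] := sq (i a).
  have [|d dE] := ses_lift U (y := f); first by rewrite /= fE (ses0 S).
  by exists d; apply: inj_i; rewrite q'E /= dE.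
- move=> y; split=> [q'y|[x <-]].
    have [|x xE] := ses_lift T (y := z y).
      by have := q'E y; rewrite q'y linear0.
    by exists x; apply: inj_z; rewrite k'E.
  by apply: inj_i; rewrite q'E /= k'E (ses0 T) linear0.
Qed.

(** The fibre product is an extension of [D] by the kernel of [p] and, by the last clause, of [B] by
    the kernel of [f]; Schanuel's argument uses both. *)
Lemma ses_pullback A B C D (i : {linear A -> B}) (p : {linear B -> C})
    (f : {linear D -> C}) : ses i p ->
  exists Z (j : {linear A -> Z}) (q : {linear Z -> D}) (g : {linear Z -> B}),
  [/\ ses j q, forall z, p (g z) = f (q z), forall a, g (j a) = i a
    & forall K (k : {linear K -> D}), ses k f -> SES K Z B].
Proof.
move=> S; have [inj_i sp _] := S.
have [Z [g [q [pgq Z0 Zex]]]] := pullback p f.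
have inj x y : g x = g y -> q x = q y -> x = y.
  move=> gxy qxy; apply/eqP; rewrite -subr_eq0; apply/eqP.
  by apply: Z0; rewrite linearB ?gxy ?qxy subrr.
have [j jE] : exists j : {linear A -> Z}, forall a, g (j a) = i a /\ q (j a) = 0.
  have ex a : exists z, g z = i a /\ q z = 0.
    by apply: Zex; rewrite (ses0 S) linear0.
  pose j a := sval (cid (ex a)).
  have jE a : g (j a) = i a /\ q (j a) = 0 by rewrite /j; case: cid.
  have [|j' j'E] := @mklin _ A Z j; last by exists j' => a; rewrite j'E.
  move=> c x y; have [gx qx] := jE x; have [gy qy] := jE y.
  have [gz qz] := jE (c *: x + y); apply: inj.
    by rewrite linearP gz gx gy -linearP.
  by rewrite linearP qz qx qy scaler0 addr0.
exists Z, j, q, g; split=> //.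
- split.
  + move=> x y /(congr1 g).
    by rewrite (proj1 (jE x)) (proj1 (jE y)) => /inj_i.
  + by move=> d; have [b bE] := sp (f d); have [z [_ <-]] := Zex b d bE; exists z.
  + move=> z; split=> [qz|[a <-]]; last by case: (jE a).
    have [|a aE] := ses_lift S (y := g z); first by rewrite pgq qz linear0.
    by have [ga qa] := jE a; exists a; apply: inj; rewrite ?ga ?qa.
- by move=> a; case: (jE a).
- move=> K k T; have [inj_k sf _] := T.
  have ex x : exists z, g z = 0 /\ q z = k x.
    by apply: Zex; rewrite (ses0 T) linear0.
  pose l x := sval (cid (ex x)).
  have lE x : g (l x) = 0 /\ q (l x) = k x by rewrite /l; case: cid.
  have [|m mE] := @mklin _ K Z l.
    move=> c x y; have [gx qx] := lE x; have [gy qy] := lE y.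
    have [gz qz] := lE (c *: x + y); apply: inj.
      by rewrite linearP gz gx gy scaler0 addr0.
    by rewrite linearP qz qx qy -linearP.
  exists m, g; split.
  + move=> x y; rewrite !mE => /(congr1 q).
    by rewrite (proj2 (lE x)) (proj2 (lE y)) => /inj_k.
  + move=> b; have [d dE] := sf (p b).
    by have [z [<- _]] := Zex b d (esym dE); exists z.
  + move=> z; split=> [gz|[x <-]]; last by rewrite mE; case: (lE x).
    have [|x xE] := ses_lift T (y := q z); first by rewrite -pgq gz linear0.
    by have [gx qx] := lE x; exists x; rewrite mE; apply: inj; rewrite ?gx ?qx.
Qed.

(** Lift PC -> C to [t : PC -> B]; then (x, y) |-> i (a x) + t y is onto B, and its kernel is an
    extension of KC by KA. *)
Lemma horseshoe A B C KA PA KC PC : SES A B C -> SES KA PA A -> SES KC PC C ->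
  projective PC -> exists KB, SES KB (PA * PC)%type B /\ SES KA KB KC.
Proof.
move=> [i [p S]] [ka [a SA]] [kc [c SC]] pPC.
have [inj_i sp _] := S; have [inj_ka sa _] := SA; have [inj_kc sc _] := SC.
have [t tE] := pPC _ _ p c sp.
have [f [g [l [m [fE gE lE mE]]]]] := prod_lin PA PC.
have [b bE] := prod_out (i \o a) t.
have [y|KB [kb SB]] := @ses_ker _ _ _ b.
  have [z zE] := sc (p y); have [|w wE] := ses_lift S (y := y - t z).
    by rewrite linearB tE zE subrr.
  by have [x xE] := sa w; exists (x, z); rewrite bE /= xE wE subrK.
have [inj_kb _ _] := SB.
exists KB; split; first by exists kb, b.
have [|u uE] := factor_inj (u := l \o ka) inj_kb.
  by move=> d; apply: (ses_lift SB); rewrite bE /= lE /= (ses0 SA) !linear0 addr0.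
have [|v vE] := factor_inj (u := g \o kb) inj_kc.
  move=> d; apply: (ses_lift SC); have := ses0 SB d; rewrite bE /= gE.
  by move/(congr1 p); rewrite linearD (ses0 S) add0r tE linear0.
exists u, v; split.
- move=> x y /(congr1 kb); rewrite !uE /= !lE => -[]; exact: inj_ka.
- move=> z; have [|w wE] := ses_lift S (y := t (kc z)); first by rewrite tE (ses0 SC).
  have [x xE] := sa w; have [|y yE] := ses_lift SB (y := (- x, kc z)).
    by rewrite bE /= !linearN xE wE addNr.
  by exists y; apply: inj_kc; rewrite vE /= yE gE.
- move=> y; split=> [vy|[x <-]]; last first.
    by apply: inj_kc; rewrite vE /= uE /= lE gE linear0.
  have : kc (v y) = 0 by rewrite vy linear0.
  rewrite vE /= gE => y2; have := ses0 SB y; rewrite bE /= y2 linear0 addr0 => y1.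
  have [|x xE] := ses_lift SA (y := (kb y).1).
    by apply: inj_i; rewrite y1 linear0.
  by exists x; apply: inj_kb; rewrite uE /= lE xE -y2; case: (kb y).
Qed.

(** * Syzygies and their independence of the presentation *)

Section Syzygies.
Implicit Types phi : lmodType R -> Prop.

(** Some k-th syzygy satisfies [phi]. The choice of [phi] gives vanishing of Ext ([E1 ^~ Q]),
    projective dimension ([projective]), Gorenstein resolutions, or the relation that N is a k-th
    syzygy ([eq^~ N]). *)
Fixpoint syz phi k M : Prop :=
  if k is k'.+1 then exists K P, [/\ SES K P M, projective P & syz phi k' K]
  else phi M.

Definition ext_closed phi := forall A B C, SES A B C -> phi A -> phi C -> phi B.

(** Such a sequence splits, so this is invariance under adding a projective summand. *)
Definition stable phi :=
  forall A B P, SES A B P -> projective P -> (phi A <-> phi B).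

Lemma syz_ext phi k : ext_closed phi -> ext_closed (syz phi k).
Proof.
move=> ec; elim: k => [//|k IH] A B C S [KA [PA [SA pA hA]]] [KC [PC [SC pC hC]]].
have [KB [SB SK]] := horseshoe S SA SC pC.
by exists KB, (PA * PC)%type; split=> //; [exact: proj_prod | exact: IH SK _ _].
Qed.

(** In positive degree A and B share a first syzygy: a cover F of A gives the cover F x P of B with
    the same kernel, and a cover F of B gives the cover ker(F -> P) of A. *)
Lemma syz_stable phi k : stable phi -> stable (syz phi k).
Proof.
case: k => [//|k] _ A B P [i [p S]] pP; split=> -[K [F [[j [q T]] pF hK]]].
- have [s [r [sK iK bE]]] := ses_split S pP.
  have [inj_i sp _] := S; have [inj_j sq _] := T.
  have [_ [_ [l [_ [_ _ lE _]]]]] := prod_lin F P.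
  have [f fE] := prod_out (i \o q) s.
  exists K, (F * P)%type; split=> //; last exact: proj_prod.
  exists (l \o j), f; split.
  + by move=> x y /=; rewrite !lE => -[/inj_j].
  + by move=> b; have [x xE] := sq (r b); exists (x, p b); rewrite fE /= xE -bE.
  + move=> [x y]; rewrite fE /=; split=> [e|[z]]; last first.
      by rewrite lE => -[<- <-]; rewrite (ses0 T) !linear0 addr0.
    have y0 : y = 0.
      by move/(congr1 p): e; rewrite linearD (ses0 S) sK add0r linear0.
    move: e; rewrite y0 linear0 addr0 => e.
    have [|z zE] := ses_lift T (y := x); first by apply: inj_i; rewrite e linear0.
    by exists z; rewrite lE zE.
- have [Z [k' [q' [z [S1 S2 _]]]]] := ker_comp S T.
  exists K, Z; split=> //; first by exists k', q'.
  by apply: proj_ker pF pP; exists z, (p \o q).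
Qed.

(** Schanuel's lemma: for two presentations, the fibre product of the projectives over M is an
    extension of each projective by the kernel of the other map. *)
Lemma syz_pres phi k K P M : stable phi -> SES K P M -> projective P ->
  (syz phi k.+1 M <-> syz phi k K).
Proof.
move=> st [i [p S]] pP; split=> [[K' [P' [[i' [p' S']] pP' h]]]|h]; last first.
  by exists K, P; split=> //; exists i, p.
have [Z [j [q [g [T _ _ U]]]]] := ses_pullback p' S.
have T' : SES K Z P' by exists j, q.
apply/(syz_stable k st T' pP'); apply/(syz_stable k st (U _ _ S') pP).
exact: h.
Qed.

End Syzygies.

(** Extend [u] in two stages along X in Z in Y, whose successive quotients are A and C. *)
Lemma E1_ext Q : ext_closed (E1 ^~ Q).
Proof.
move=> A B C [i [p S]] hA hC X Y j q T u.
have [Z [k' [q' [z [S1 S2 zE]]]]] := ker_comp S T.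
have [v vE] := hA _ _ _ _ S1 u; have [w wE] := hC _ _ _ _ S2 v.
by exists w => x; rewrite -zE wE vE.
Qed.

Lemma E1_stable Q : stable (E1 ^~ Q).
Proof.
move=> A B P S pP; split=> [hA|hB]; first exact: E1_ext S hA (E1_proj pP).
have [K [F [[j [q T]] pF]]] := pres_ex B; move: S => [i [p S]].
have [Z [k' [q' [z [S1 S2 zE]]]]] := ker_comp S T.
apply: E1_pres S1 _ _.
  by apply: proj_ker pF pP; exists z, (p \o q).
move=> u; have [v vE] := hB _ _ _ _ T u.
by exists (v \o z) => x /=; rewrite zE vE.
Qed.

Lemma proj_stable : stable (@projective R).
Proof.
move=> A B P S pP; split=> h; [exact: proj_ext S h pP | exact: proj_ker S h pP].
Qed.

(* Ext^(k+1)(M, Q) = 0: note the shift in the index. *)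
Definition EV k M Q := syz (E1 ^~ Q) k M.

Definition pdle := syz (@projective R).

Lemma EV_pres k K P M Q : SES K P M -> projective P -> (EV k.+1 M Q <-> EV k K Q).
Proof. exact/syz_pres/E1_stable. Qed.

Lemma EV_ext k Q : ext_closed (EV k ^~ Q).
Proof. exact/syz_ext/E1_ext. Qed.

Lemma EV_proj k P Q : projective P -> EV k P Q.
Proof.
elim: k P => [|k IH] P pP; first exact: E1_proj.
have [K [F [S pF]]] := pres_ex P; apply/(EV_pres _ _ S pF)/IH.
exact: proj_ker S pF pP.
Qed.

(** [Z] is the preimage of [A] in [P], hence a first syzygy of [C]. This rotation yields the long
    exact sequence below. *)
Lemma rotate A B C K P : SES A B C -> SES K P B -> exists Z, SES K Z A /\ SES Z P C.
Proof.
move=> [i [p S]] [j [q T]]; have [Z [k' [q' [z [S1 S2 _]]]]] := ker_comp S T.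
by exists Z; split; [exists k', q' | exists z, (p \o q)].
Qed.

(** Exactness of Ext^(k+1)(A, Q) -> Ext^(k+2)(C, Q) -> Ext^(k+2)(B, Q). *)
Lemma EV_coker k A B C Q : SES A B C -> EV k A Q -> EV k.+1 B Q -> EV k.+1 C Q.
Proof.
move=> S hA hB; have [K [P [T pP]]] := pres_ex B.
have [Z [S1 S2]] := rotate S T; apply/(EV_pres _ _ S2 pP).
by apply: EV_ext S1 _ hA; apply/(EV_pres _ _ T pP).
Qed.

(** Exactness of Ext^(k+2)(B, Q) -> Ext^(k+2)(A, Q) -> Ext^(k+3)(C, Q), by rotating once and
    applying [EV_coker]. *)
Lemma EV_ker k A B C Q : SES A B C -> EV k.+1 B Q -> EV k.+2 C Q -> EV k.+1 A Q.
Proof.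
move=> S hB hC; have [K [P [T pP]]] := pres_ex B.
have [Z [S1 S2]] := rotate S T; apply: EV_coker S1 _ _.
  exact/(EV_pres _ _ T pP).
exact/(EV_pres _ _ S2 pP).
Qed.

(** The long exact sequence in the second variable. In degree 0, a map K -> C lifts to B because the
    pulled back extension of K by A splits; the lift extends to P and is pushed down to C. *)
Lemma EV_target k M A B C : SES A B C -> EV k M B -> EV k.+1 M A -> EV k M C.
Proof.
move=> [i [p S]]; have [inj_i sp _] := S.
elim: k M => [|k IH] M hB hA; have [K [P [T pP]]] := pres_ex M; last first.
  apply/(EV_pres _ _ T pP); apply: IH; first exact/(EV_pres _ _ T pP).
  exact/(EV_pres _ _ T pP).
have {}hA : E1 K A by exact/(EV_pres 0 _ T pP).
move: T => [j [q T]]; apply: (E1_pres T pP) => u.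
have [Z [a [b [g [S1 gE ga _]]]]] := ses_pullback u S.
have [r rE] := hA _ _ _ _ S1 idfun; have [inj_a sb _] := S1.
have [|w wE] := @factor_surj _ _ _ _ b (g \- (i \o r)) sb.
  move=> z /(ses_lift S1)[x <-] /=; rewrite ga rE subrr //.
have [v vE] := hB _ _ _ _ T w.
exists (p \o v) => x /=; rewrite vE; have [z <-] := sb x.
by rewrite wE /= linearB gE (ses0 S) subr0.
Qed.

Lemma pdle_S k M : pdle k M -> pdle k.+1 M.
Proof.
elim: k M => [|k IH] M; last by move=> [K [P [S pP /IH h]]]; exists K, P.
move=> pM; have [K [P [S pP]]] := pres_ex M; exists K, P; split=> //.
exact: proj_ker S pP pM.
Qed.

Lemma pdle_leq k l M : (k <= l)%N -> pdle k M -> pdle l M.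
Proof. by elim: l => [|l IH]; rewrite leq_eqVlt => /orP[/eqP->|] // /IH h /h /pdle_S. Qed.

Definition fpd M := exists k, pdle k M.

Lemma fpd_ext : ext_closed fpd.
Proof.
move=> A B C S [k hA] [l hC]; exists (maxn k l).
apply: syz_ext S _ _; first exact: proj_ext.
  by apply: pdle_leq hA; exact: leq_maxl.
by apply: pdle_leq hC; exact: leq_maxr.
Qed.

Lemma fpd_proj P : projective P -> fpd P. Proof. by exists 0%N. Qed.

Lemma fpd_pres K P M : SES K P M -> projective P -> (fpd M <-> fpd K).
Proof.
move=> S pP; split=> [|[k h]]; last by exists k.+1; exists K, P.
move=> [[|k] h]; first by apply/fpd_proj/proj_ker; [exact: S| |].
by exists k; apply/(syz_pres k proj_stable S pP).
Qed.

Lemma fpd_coker A B C : SES A B C -> fpd A -> fpd B -> fpd C.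
Proof.
move=> S hA hB; have [K [P [T pP]]] := pres_ex B.
have [Z [S1 S2]] := rotate S T; apply/(fpd_pres S2 pP).
by apply: fpd_ext S1 _ hA; apply/(fpd_pres T pP).
Qed.

(* All the groups Ext^k(M, Q) with k > 0 and Q projective vanish. *)
Definition perp M := forall k Q, projective Q -> EV k M Q.

Lemma perp_fpd M H : perp M -> fpd H -> forall k, EV k M H.
Proof.
move=> hM [m]; elim: m H => [|m IH] H; first by move=> pH k; exact: hM.
move=> [K [P [S pP hK]]] k; apply: EV_target S _ _; first exact: hM.
exact: IH.
Qed.

(** The first syzygy K also has finite projective dimension, so Ext^1(M, K) = 0 and the presentation
    of M splits. *)
Lemma perp_fpd_proj M : perp M -> fpd M -> projective M.
Proof.
move=> hM fM; have [K [P [S pP]]] := pres_ex M.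
have fK : fpd K by apply/(fpd_pres S pP).
move: S => [i [p S]]; have [r rE] := perp_fpd hM fK 0%N _ _ _ _ S idfun.
have [_ sp _] := S.
have [|s sE] := @factor_surj _ _ _ _ p (idfun \- (i \o r)) sp.
  by move=> b /(ses_lift S)[x <-] /=; rewrite rE subrr.
apply: (proj_retract (s := s) (r := p)) pP => m; have [x <-] := sp m.
by rewrite sE /= linearB (ses0 S) subr0.
Qed.

Lemma perp_ext : ext_closed perp.
Proof. by move=> A B C S hA hC k Q pQ; apply: EV_ext S _ _; [exact: hA|exact: hC]. Qed.

End Homological.

(** * Gorenstein projective modules *)

Section Gorenstein.
Variable R : comNzRingType.
Implicit Types A B C D E G H J K L M N P Q Z : lmodType R.
Local Notation GP := (@Gorenstein_projective R).

Definition prepend M (F : nat -> lmodType R) i := if i is i'.+1 then F i' else M.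

Lemma link_exact A B C L J (c : {linear A -> L}) (k : {linear L -> B})
    (p : {linear B -> J}) (i : {linear J -> C}) :
  (forall l, exists a, c a = l) -> ses k p -> injective i ->
  exact_at (k \o c) (i \o p).
Proof.
move=> sc S inj_i y; split=> /= [ipy|[x <-]]; last by rewrite (ses0 S) linear0.
have [|l <-] := ses_lift S (y := y); first by apply: inj_i; rewrite ipy linear0.
by have [a <-] := sc l; exists a.
Qed.

(** A map killed on the left factors through J, and then extends from J to C because Ext^1 of the
    next cokernel N vanishes. *)
Lemma link_hom_exact Q A B C L J N (c : {linear A -> L}) (k : {linear L -> B})
    (p : {linear B -> J}) (i : {linear J -> C}) (q : {linear C -> N}) :
  (forall l, exists a, c a = l) -> ses k p -> ses i q -> E1 N Q ->
  hom_exact_at Q (k \o c) (i \o p).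
Proof.
move=> sc S T hN u; split=> /= [uk|[v vE] x]; last first.
  by rewrite -vE /= (ses0 S) !linear0.
have [_ sp _] := S; have [|w wE] := factor_surj (u := u) sp.
  by move=> b /(ses_lift S)[l <-]; have [a <-] := sc l; exact: uk.
by have [v vE] := hN _ _ _ _ T w; exists v => y; rewrite vE wE.
Qed.

(** A choice of presentation bundled as data, so that [omega] can iterate it; [emb_data] does the
    same for embeddings. *)
Record pres_data M := PresData {
  pr_ker : lmodType R; pr_mod : lmodType R;
  pr_in : {linear pr_ker -> pr_mod}; pr_out : {linear pr_mod -> M};
  pr_ses : ses pr_in pr_out; pr_proj : projective pr_mod }.

Lemma pres_data_ex M : exists _ : pres_data M, True.
Proof.
by have [K [P [[i [p S]] pP]]] := pres_ex M; exists (PresData S pP).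
Qed.

Definition pres M : pres_data M := sval (cid (pres_data_ex M)).

Fixpoint omega M k : lmodType R :=
  if k is k'.+1 then pr_ker (pres (omega M k')) else M.

Section Coinduction.
Variable G : lmodType R -> Prop.
Hypothesis G_perp : forall N, G N -> perp N.
Hypothesis G_emb : forall N, G N -> exists P N', [/\ SES N P N', projective P & G N'].

Record emb_data N := EmbData {
  em_mod : lmodType R; em_cok : lmodType R;
  em_in : {linear N -> em_mod}; em_out : {linear em_mod -> em_cok};
  em_ses : ses em_in em_out; em_proj : projective em_mod; em_G : G em_cok }.

Lemma emb_data_ex N : G N -> exists _ : emb_data N, True.
Proof.
by move=> /G_emb[P [N' [[i [p S]] pP GN']]]; exists (EmbData S pP GN').
Qed.

Definition emb (s : {N | G N}) : emb_data (sval s) :=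
  sval (cid (emb_data_ex (svalP s))).

Fixpoint coomega (s : {N | G N}) k : {N | G N} :=
  if k is k'.+1 then exist G _ (em_G (emb (coomega s k'))) else s.

(* The complex is spliced from projective presentations on the left and the given
   embeddings on the right; Hom(-, Q) keeps it exact because Ext^1(N, Q) = 0 for
   every N at which two pieces are joined. *)
Lemma GP_coind M : G M -> GP M.
Proof.
move=> GM; pose Om := omega M; pose st := coomega (exist G M GM).
pose dm i : {linear pr_mod (pres (Om i.+1)) -> pr_mod (pres (Om i))} :=
  pr_in (pres (Om i)) \o pr_out (pres (Om i.+1)).
pose mm : {linear pr_mod (pres M) -> em_mod (emb (st 0%N))} :=
  em_in (emb (st 0%N)) \o pr_out (pres M).
pose um i : {linear em_mod (emb (st i)) -> em_mod (emb (st i.+1))} :=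
  em_in (emb (st i.+1)) \o em_out (emb (st i)).
have sur i l : exists a, pr_out (pres (Om i)) a = l.
  by have [_ sp _] := pr_ses (pres (Om i)); exact: sp.
have sur' i l : exists a, em_out (emb (st i)) a = l.
  by have [_ sp _] := em_ses (emb (st i)); exact: sp.
have inj_u i : injective (em_in (emb (st i))) by have [] := em_ses (emb (st i)).
have inj_d i : injective (pr_in (pres (Om i))) by have [] := pr_ses (pres (Om i)).
have perp_u i : perp (em_cok (emb (st i))).
  by apply: G_perp; exact: em_G.
exists (@Biseq R (fun i => pr_mod (pres (Om i))) (fun i => em_mod (emb (st i)))
  dm mm um); split=> /=.
- by move=> i; split; [exact: pr_proj | exact: em_proj].
- split=> /= [i|||i].
  + exact: (link_exact (sur i.+2) (pr_ses (pres (Om i.+1))) (inj_d i)).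
  + exact: (link_exact (sur 1%N) (pr_ses (pres M)) (inj_u 0%N)).
  + exact: (link_exact (sur 0%N) (em_ses (emb (st 0%N))) (inj_u 1%N)).
  + exact: (link_exact (sur' i) (em_ses (emb (st i.+1))) (inj_u i.+2)).
- move=> Q pQ; have hu i : E1 (em_cok (emb (st i))) Q by exact: (perp_u i 0%N Q pQ).
  have perpO i : perp (Om i).
    elim: i => [|i IH]; first exact: G_perp.
    move=> k Q' pQ'; apply/(EV_pres k Q' (P := pr_mod (pres (Om i))) (M := Om i)).
    - by exists (pr_in (pres (Om i))), (pr_out (pres (Om i))); exact: pr_ses.
    - exact: pr_proj.
    - exact: IH.
  split=> /= [i|||i].
  + exact: (link_hom_exact (sur i.+2) (pr_ses (pres (Om i.+1)))
      (pr_ses (pres (Om i))) (perpO i 0%N Q pQ)).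
  + exact: (link_hom_exact (sur 1%N) (pr_ses (pres M)) (em_ses (emb (st 0%N))) (hu 0%N)).
  + exact: (link_hom_exact (sur 0%N) (em_ses (emb (st 0%N)))
      (em_ses (emb (st 1%N))) (hu 1%N)).
  + exact: (link_hom_exact (sur' i) (em_ses (emb (st i.+1)))
      (em_ses (emb (st i.+2))) (hu i.+2)).
- exists (em_in (emb (st 0%N))); split=> [|y]; first exact: inj_u.
  split=> [[m <-]|[x <-]].
    by have [x <-] := sur 0%N m; exists x.
  by exists (pr_out (pres M) x).
Qed.
End Coinduction.

Lemma GP_iso M N (f : {linear N -> M}) : injective f ->
  (forall m, exists n, f n = m) -> GP M -> GP N.
Proof.
move=> inj_f sf [P [h1 h2 h3 [j [inj_j jE]]]]; exists P; split=> //.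
exists (j \o f); split=> [|y]; first exact: inj_comp.
rewrite -jE; split=> [[n <-]|[m <-]]; first by exists (f n).
by have [n <-] := sf m; exists n.
Qed.

(** Shifting the complex one place makes ker(P_0 -> M) the middle image. Vanishing of Ext^1(M, Q) is
    exactness of Hom(-, Q) at P_1: a map on K, pulled back to P_1, extends to P_0. *)
Lemma GP_left M : GP M -> exists K P,
  [/\ SES K P M, projective P, GP K & forall Q, projective Q -> E1 M Q].
Proof.
move=> [P [h1 [e1 e2 e3 e4] h3 [j [inj_j jE]]]].
have [|e eE] := factor_inj (u := mid_map P) inj_j.
  by move=> d; apply/jE; exists d.
have se m : exists x, e x = m.
  have [|x xE] := (jE (j m)).1; first by exists m.
  by exists x; apply: inj_j; rewrite eE.
have [K [k S]] := ses_ker se; have [inj_k _ _] := S.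
have [|c cE] := factor_inj (u := dn_map P 0) inj_k.
  move=> d; apply: (ses_lift S); apply: inj_j; rewrite eE linear0.
  by apply/e2; exists d.
have sc z : exists y, c y = z.
  have [|y yE] := (e2 (k z)).1; first by rewrite -eE (ses0 S) linear0.
  by exists y; apply: inj_k; rewrite cE.
exists K, (dn P 0%N); split.
- by exists k, e.
- by case: (h1 0%N).
- exists (@Biseq R (fun i => dn P i.+1) (prepend (dn P 0%N) (up P))
    (fun i => dn_map P i.+1) (dn_map P 0)
    (fun i => if i is i'.+1 return {linear prepend (dn P 0%N) (up P) i -> up P i}
      then up_map P i' else mid_map P)).
  split=> /=.
  + by move=> [|i]; split; first [exact: (h1 _).1 | exact: (h1 _).2].
  + by split=> /= [i|||[|i]]; [exact: e1|exact: e1|exact: e2|exact: e3|exact: e4].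
  + move=> Q pQ; have [f1 f2 f3 f4] := h3 Q pQ.
    by split=> /= [i|||[|i]]; [exact: f1|exact: f1|exact: f2|exact: f3|exact: f4].
  + exists k; split=> // y; split=> [[z <-]|[x <-]].
      by have [x <-] := sc z; exists x.
    by exists (c x); rewrite cE.
- move=> Q pQ; apply: E1_pres S (h1 0%N).1 _ => u.
  have [f1 _ _ _] := h3 Q pQ.
  have [|v vE] := (f1 0%N (u \o c)).1.
    move=> x /=; suff -> : c (dn_map P 1 x) = 0 by rewrite linear0.
    by apply: inj_k; rewrite cE linear0; apply/(e1 0%N); exists x.
  by exists v => z; have [y <-] := sc z; rewrite cE vE.
Qed.

Lemma GP_right M : GP M -> exists P N, [/\ SES M P N, projective P & GP N].
Proof.
move=> [P [h1 [e1 e2 e3 e4] h3 [j [inj_j jE]]]].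
have [N [q S]] := ses_coker inj_j; have [_ sq _] := S.
have [|k kE] := factor_surj (u := up_map P 0) sq.
  by move=> b /(ses_lift S)[m <-]; apply/e3/jE; exists m.
exists (up P 0), N; split; [by exists j, q | by case: (h1 0%N) |].
exists (@Biseq R (prepend (up P 0%N) (dn P)) (fun i => up P i.+1)
    (fun i => if i is i'.+1 return {linear dn P i -> prepend (up P 0%N) (dn P) i}
      then dn_map P i' else mid_map P)
    (up_map P 0) (fun i => up_map P i.+1)).
split=> /=.
+ by move=> [|i]; split; first [exact: (h1 _).1 | exact: (h1 _).2].
+ by split=> /= [[|i]|||i]; [exact: e2|exact: e1|exact: e3|exact: e4|exact: e4].
+ move=> Q pQ; have [f1 f2 f3 f4] := h3 Q pQ.
  by split=> /= [[|i]|||i]; [exact: f2|exact: f1|exact: f3|exact: f4|exact: f4].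
+ exists k; split=> [|y].
    apply: inj_ker => n; have [b <-] := sq n; rewrite kE => /e3/jE[m <-].
    by rewrite (ses0 S).
  split=> [[n <-]|[x <-]]; first by have [b <-] := sq n; exists b; rewrite kE.
  by exists (q x); rewrite kE.
Qed.

Lemma GP_perp M : GP M -> perp M.
Proof.
move=> gM k Q pQ; elim: k M gM => [|k IH] M /GP_left[K [P [S pP gK hM]]].
  exact: hM.
by apply/(EV_pres _ _ S pP)/IH.
Qed.

Lemma SES_prod A B : SES A (A * B)%type B.
Proof.
have [f [g [i [j [fE gE iE jE]]]]] := prod_lin A B.
exists i, g; split=> [x y|b|[x y]]; first by rewrite !iE => -[].
  by exists (j b); rewrite gE jE.
rewrite gE /=; split=> [->|[a]]; first by exists x; rewrite iE.
by rewrite iE => -[].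
Qed.

(** Coinduction on the class of projectives: N embeds in N x N with cokernel N. *)
Lemma GP_proj P : projective P -> GP P.
Proof.
apply: GP_coind => N pN; first by move=> k Q _; exact: EV_proj.
by exists (N * N)%type, N; split=> //; [exact: SES_prod | exact: proj_prod].
Qed.

(** Dual to [horseshoe], with Ext^1(C, PA) = 0 playing the role of a lifting property: it extends A
    -> PA to E. *)
Lemma cohorseshoe A E C PA PC A' C' : SES A E C -> SES A PA A' -> SES C PC C' ->
  E1 C PA -> exists E', SES E (PA * PC)%type E' /\ SES A' E' C'.
Proof.
move=> [i [p S]] [a [qa SA]] [c [qc SC]] hC.
have [inj_i sp _] := S; have [inj_a sa _] := SA; have [inj_c sc _] := SC.
have [v vE] := hC _ _ _ _ S a.
have [f [g [l [m [fE gE lE mE]]]]] := prod_lin PA PC.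
have [h hE] := prod_in v (c \o p).
have inj_h : injective h.
  apply: inj_ker => e; rewrite hE /= => -[ve cpe].
  have [|x xE] := ses_lift S (y := e); first by apply: inj_c; rewrite cpe linear0.
  by rewrite -xE (inj_a x 0) ?linear0 // -vE xE.
have [E' [q T]] := ses_coker inj_h; exists E'; split; first by exists h, q.
have [_ sq _] := T.
have [|u uE] := factor_surj (u := q \o l) sa.
  move=> b /(ses_lift SA)[x <-] /=.
  suff -> : l (a x) = h (i x) by rewrite (ses0 T).
  by rewrite lE hE /= vE (ses0 S) linear0.
have [|w wE] := factor_surj (u := qc \o g) sq.
  by move=> b /(ses_lift T)[x <-] /=; rewrite gE hE /= (ses0 SC).
exists u, w; split.
- apply: inj_ker => a'; have [x <-] := sa a'; rewrite uE /= => /(ses_lift T)[e].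
  rewrite hE lE /= => -[ve cpe].
  have [|y yE] := ses_lift S (y := e); first by apply: inj_c; rewrite cpe linear0.
  by rewrite -ve -yE vE (ses0 SA).
- move=> c'; have [y <-] := sc c'; exists (q (m y)).
  by rewrite wE /= gE mE.
- move=> e'; split=> [|[a' <-]]; last first.
    by have [x <-] := sa a'; rewrite uE /= wE /= gE lE linear0.
  have [[x y] <-] := sq e'; rewrite wE /= gE /= => /(ses_lift SC)[z zE].
  have [e eE] := sp z; exists (qa (x - v e)); rewrite uE /=.
  apply/eqP; rewrite -subr_eq0 -linearB; apply/eqP.
  have -> : l (x - v e) - (x, y) = - h e.
    rewrite lE hE /= eE zE; congr (_, _); rewrite /= ?sub0r //.
    by rewrite addrAC subrr sub0r.
  by rewrite linearN (ses0 T) oppr0.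
Qed.

(** Coinduction on the class of extensions of two Gorenstein projectives: [cohorseshoe] embeds such
    a module in a projective with cokernel of the same kind. *)
Lemma GP_ext : ext_closed GP.
Proof.
move=> A B C S gA gC.
apply: (@GP_coind (fun E => exists A C, [/\ SES A E C, GP A & GP C])); last first.
- by exists A, C.
- move=> N [A1 [C1 [S1 gA1 gC1]]].
  have [PA [A' [SA pPA gA']]] := GP_right gA1.
  have [PC [C' [SC pPC gC']]] := GP_right gC1.
  have [E' [T1 T2]] := cohorseshoe S1 SA SC (GP_perp gC1 0%N pPA).
  exists (PA * PC)%type, E'; split=> //; first exact: proj_prod.
  by exists A', C'.
- by move=> N [A1 [C1 [S1 /GP_perp gA1 /GP_perp gC1]]]; exact: perp_ext S1 gA1 gC1.
Qed.

(** * Gorenstein projective resolutions and the two conditions *)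

Lemma Gres0 M : Gproj_resolution M 0 <-> GP M.
Proof.
split=> [[G [d [e [h1 h2 h3 h4 h5]]]]|gM].
  have [f fE] : exists f : {linear M -> G 0%N}, cancel e f /\ cancel f e.
    have [|f fE] := factor_surj (u := idfun) h3.
      by move=> b /h4[x <-] /=; rewrite (h2 1%N _ x) // linear0.
    by exists f; split=> // m; have [x <-] := h3 m; rewrite fE.
  apply: (GP_iso (f := f)) (h1 0%N _) => //; first exact: can_inj fE.2.
  by move=> m; exists (e m); rewrite fE.1.
pose G := prepend M (fun _ => 'rV[R]_0 : lmodType R).
exists G, (fun i => if i is 0 return {linear G i.+1 -> G i} then \0 else \0).
exists idfun; split=> [[|//] _|[//|i] _ x|m|y|i y] //=.
- by rewrite [x]thinmx0.
- by exists m.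
- by split=> [->|[x <-]]; first by exists 0.
- by case: i y => [|i] y; split=> _ //; exists 0; rewrite [y]thinmx0 [LHS]thinmx0.
Qed.

Lemma GresS M k : Gproj_resolution M k.+1 <->
  exists K P, [/\ SES K P M, GP P & Gproj_resolution K k].
Proof.
split=> [[G [d [e [h1 h2 h3 h4 h5]]]]|[K [P [[i [p S]] gP [G [d [e [h1 h2 h3 h4 h5]]]]]]]].
  have [K [i S]] := ses_ker h3; exists K, (G 0%N); split; [by exists i, e|exact: h1|].
  have [inj_i _ _] := S.
  have [|f fE] := factor_inj (u := d 0%N) inj_i.
    by move=> x; apply: (ses_lift S); apply/h4; exists x.
  exists (fun i => G i.+1), (fun i => d i.+1), f; split=> //.
  - by move=> j hj; exact: h1.
  - by move=> j hj; exact: h2.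
  - move=> m; have [|x xE] := (h4 (i m)).1; first exact: (ses0 S).
    by exists x; apply: inj_i; rewrite fE.
  - move=> y; split=> [fy|/h5 dy]; first by apply/h5; rewrite -fE fy linear0.
    by apply: inj_i; rewrite fE dy linear0.
have [inj_i sp _] := S.
exists (prepend P G), (fun j => if j is j'.+1 return {linear G j -> prepend P G j}
  then d j' else i \o e).
exists p; split=> //=.
- by move=> [|j] hj //; exact: h1.
- by move=> [|j] hj //; exact: h2.
- move=> y; split=> [/(ses_lift S)[x <-]|[x <-]]; last exact: (ses0 S).
  by have [z <-] := h3 x; exists z.
- move=> [|j] y /=; last exact: h5.
  split=> [ie|/h4 ->]; last by rewrite linear0.
  by apply/h4/inj_i; rewrite ie linear0.
Qed.

(** Dual to [ses_pullback]: the pushout is an extension of [C] by [D] and, when [f] is injective, of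
    its cokernel by [B]. *)
Lemma ses_pushout A B C D (i : {linear A -> B}) (p : {linear B -> C})
    (f : {linear A -> D}) : ses i p ->
  exists Z, SES D Z C /\ forall N (q : {linear D -> N}), ses f q -> SES B Z N.
Proof.
move=> S; have [inj_i sp _] := S.
have [Z [a [b [ab ker gen]]]] := pushout i f.
have desc N (u : {linear B -> N}) (v : {linear D -> N}) :
    (forall x, u (i x) = v (f x)) ->
    exists w : {linear Z -> N}, (forall x, w (a x) = u x) /\ forall y, w (b y) = v y.
  move=> uv; have [g gE] := prod_out a b; have [h hE] := prod_out u v.
  have [|| w wE] := @factor_surj _ _ _ _ g h.
  - by move=> e; have [x [y ->]] := gen e; exists (x, y); rewrite gE.
  - move=> [x y]; rewrite gE hE /= => /eqP; rewrite addr_eq0 -linearN => /eqP/ker[z].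
    by move=> [<- fz]; rewrite uv fz linearN addNr.
  exists w; split=> [x|y].
    by have := wE (x, 0); rewrite gE hE /= !linear0 !addr0.
  by have := wE (0, y); rewrite gE hE /= !linear0 !add0r.
exists Z; split=> [|N q T].
  have [|w [wa wb]] := desc C p \0; first by move=> x /=; rewrite (ses0 S).
  exists b, w; split=> [|c|e].
  - apply: inj_ker => y by_; have [|z [iz <-]] := ker 0 y; first by rewrite linear0.
    by rewrite (inj_i z 0) ?linear0.
  - by have [x <-] := sp c; exists (a x).
  - split=> [|[y <-]]; last by rewrite wb.
    have [x [y ->]] := gen e; rewrite linearD wa wb /= addr0.
    by move=> /(ses_lift S)[z <-]; exists (f z + y); rewrite linearD ab.
have [inj_f sq _] := T.
have [|w [wa wb]] := desc N \0 q; first by move=> x /=; rewrite (ses0 T).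
exists a, w; split=> [|c|e].
- apply: inj_ker => y ay; have [|z [<- fz]] := ker y 0; first by rewrite linear0.
  by rewrite (inj_f z 0) ?linear0.
- by have [x <-] := sq c; exists (b x).
- split=> [|[y <-]]; last by rewrite wa.
  have [x [y ->]] := gen e; rewrite linearD wa wb /= add0r.
  by move=> /(ses_lift T)[z <-]; exists (x + i z); rewrite linearD ab.
Qed.

Lemma third_iso H E M P G : SES H E M -> SES E P G ->
  exists C, SES H P C /\ SES M C G.
Proof.
move=> [i [p S]] [j [q T]]; have [inj_i sp _] := S; have [inj_j sq _] := T.
have [C [r U]] := ses_coker (inj_comp inj_j inj_i); exists C.
have [_ sr _] := U; split; first by exists (j \o i), r.
have [|u uE] := factor_surj (u := r \o j) sp.
  by move=> e /(ses_lift S)[h <-]; exact: (ses0 U h).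
have [|v vE] := factor_surj (u := q) sr.
  by move=> e /(ses_lift U)[h <-]; exact: (ses0 T (i h)).
exists u, v; split=> [|g|c].
- apply: inj_ker => m; have [e <-] := sp m; rewrite uE => /(ses_lift U)[h /inj_j <-].
  exact: (ses0 S).
- by have [x <-] := sq g; exists (r x).
- have [x <-] := sr c; rewrite vE; split=> [/(ses_lift T)[e <-]|[m]].
    by exists (p e); rewrite uE.
  have [e <-] := sp m; rewrite uE /= => /eqP; rewrite -subr_eq0 -linearB.
  move=> /eqP/(ses_lift U)[h /= hE].
  have -> : x = j (e - i h) by rewrite linearB hE opprB addrC subrK.
  exact: ses0 T _.
Qed.

(** Given a hull K -> H with cokernel G, let E be the pushout of P and H along K. E is an extension
    of G by P, hence Gorenstein projective, and embeds in a projective P'. Then M = E/H lies in P'/H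
    with cokernel P'/E. *)
Lemma Gres_fpd_hull k M : Gproj_resolution M k ->
  exists H G, [/\ SES M H G, fpd H & GP G].
Proof.
elim: k M => [|k IH] M.
  by move/Gres0/GP_right => [P [N [S pP gN]]]; exists P, N; split=> //; exact: fpd_proj.
move/GresS => [K [P [[i [p S]] gP /IH[H [G [[j [q T]] fH gG]]]]]].
have [E [T1 T2]] := ses_pushout j S.
have [P' [N [U pP' gN]]] := GP_right (GP_ext (T2 _ _ T) gP gG).
have [C [U1 U2]] := third_iso T1 U; exists C, N; split=> //.
exact: fpd_coker U1 fH (fpd_proj pP').
Qed.

Lemma Gres_EV k M j Q : Gproj_resolution M k -> (k <= j)%N -> projective Q -> EV j M Q.
Proof.
move=> + + pQ; elim: k M j => [|k IH] M j; first by move=> /Gres0/GP_perp h _; exact: h.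
case: j => // j /GresS[K [P [S gP hK]]] kj; apply: EV_coker S _ _; first exact: IH.
exact: GP_perp.
Qed.

(** Bounding the length, rather than fixing it, is what [Gpd M] being at most n means by
    [least_le]. *)
Definition Gdim_le n := forall M, exists2 k, (k <= n)%N & Gproj_resolution M k.

Lemma Gdim_le_hull n : Gdim_le n ->
  forall M, exists H G, [/\ SES M H G, fpd H & GP G].
Proof. by move=> h M; have [k _ /Gres_fpd_hull] := h M. Qed.

Lemma Gdim_le_EV n : Gdim_le n -> forall M Q, projective Q -> EV n M Q.
Proof. by move=> h M Q pQ; have [k kn hk] := h M; exact: Gres_EV hk kn pQ. Qed.

(** The syzygy [N] is prescribed, and those of B and C are produced to fit: the coinduction in
    [Gdim_leP] has to embed a given syzygy. *)
Lemma syz_horseshoe n A B C N : SES A B C -> syz (eq^~ N) n A ->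
  exists Y N', [/\ SES N Y N', syz (eq^~ Y) n B & syz (eq^~ N') n C].
Proof.
elim: n A B C => [|n IH] A B C S /=; first by move=> <-; exists B, C.
move=> [KA [PA [SA pA hA]]]; have [KC [PC [SC pC]]] := pres_ex C.
have [KB [SB SK]] := horseshoe S SA SC pC.
have [Y [N' [T hY hN']]] := IH _ _ _ SK hA.
exists Y, N'; split=> //; last by exists KC, PC.
by exists KB, (PA * PC)%type; split=> //; exact: proj_prod.
Qed.

Lemma syz_EV n k N M Q : syz (eq^~ N) n M -> EV (n + k) M Q -> EV k N Q.
Proof.
elim: n M => [|n IH] M /=; first by move=> ->.
by move=> [K [P [S pP h]]] /(EV_pres _ _ S pP); exact: IH.
Qed.

Lemma syz_fpd n N M : syz (eq^~ N) n M -> fpd M -> fpd N.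
Proof.
elim: n M => [|n IH] M /=; first by move=> ->.
by move=> [K [P [S pP h]]] /(fpd_pres S pP); exact: IH.
Qed.

Lemma syz_GP n M : syz GP n M -> Gproj_resolution M n.
Proof.
elim: n M => [|n IH] M /=; first by move/Gres0.
move=> [K [P [S pP /IH h]]]; apply/GresS; exists K, P; split=> //; exact: GP_proj.
Qed.

Lemma syz_sub n M : exists N, syz (eq^~ N) n M.
Proof.
elim: n M => [|n IH] M /=; first by exists M.
have [K [P [S pP]]] := pres_ex M; have [N hN] := IH K.
by exists N, K, P.
Qed.

Lemma syz_weaken (phi : lmodType R -> Prop) n N M :
  syz (eq^~ N) n M -> phi N -> syz phi n M.
Proof.
move=> + hN; elim: n M => [|n IH] M /=; first by move=> ->.
by move=> [K [P [S pP /IH h]]]; exists K, P.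
Qed.

Lemma Gdim_leP n :
  (forall M, exists H (i : {linear M -> H}), injective i /\ fpd H) ->
  (forall M Q, projective Q -> EV n M Q) -> Gdim_le n.
Proof.
move=> hull ev M; exists n => //; have [N hN] := syz_sub n M.
apply: syz_GP; apply: (syz_weaken hN).
(* Ext^(k+1)(N', Q) is Ext^(n+k+1)(M', Q), that is, Ext^(n+1) of a k-th syzygy of M', which (b)
   kills. *)
have perp_syz N' : (exists M', syz (eq^~ N') n M') -> perp N'.
  move=> [M' h] k Q pQ; apply: syz_EV h _; elim: k M' => [|k IH] M'.
    by rewrite addn0; exact: ev.
  have [K [P [S pP]]] := pres_ex M'; rewrite addnS.
  by apply/(EV_pres _ _ S pP); exact: IH.
apply: (@GP_coind (fun N => exists M, syz (eq^~ N) n M)); last by exists M.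
  exact: perp_syz.
move=> N1 [M1 h1]; have [H [i [inj_i fH]]] := hull M1.
have [C [p S]] := ses_coker inj_i.
have [|Y [N' [T hY hN']]] := @syz_horseshoe n M1 H C N1 _ h1; first by exists i, p.
exists Y, N'; split=> //; last by exists C.
apply: perp_fpd_proj; first by apply: perp_syz; exists H.
exact: syz_fpd hY fH.
Qed.

End Gorenstein.

(** * Restriction of scalars *)

Module Restriction.
(** A synonym of [N] that carries [phi] in its type, so that the two scalar actions do not clash. *)
Definition resm (R S : comNzRingType) (phi : {rmorphism R -> S}) (N : lmodType S) :
  Type := N.

Section Restriction.
Variables (R S : comNzRingType) (phi : {rmorphism R -> S}).
Local Notation resm := (resm phi).

Section Module.
Variable N : lmodType S.
HB.instance Definition _ := GRing.Zmodule.on (resm N).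
Definition resm_scale (a : R) (x : resm N) : resm N := phi a *: (x : N).
Lemma resm_scaleA a b x : resm_scale a (resm_scale b x) = resm_scale (a * b) x.
Proof. by rewrite /resm_scale scalerA rmorphM. Qed.
Lemma resm_scale1 : left_id 1 resm_scale.
Proof. by move=> x; rewrite /resm_scale rmorph1 scale1r. Qed.
Lemma resm_scaleDr : right_distributive resm_scale +%R.
Proof. by move=> a x y; rewrite /resm_scale scalerDr. Qed.
Lemma resm_scaleDl x : {morph resm_scale^~ x : a b / a + b}.
Proof. by move=> a b; rewrite /resm_scale rmorphD scalerDl. Qed.
HB.instance Definition _ := GRing.Zmodule_isLmodule.Build R (resm N)
  resm_scaleA resm_scale1 resm_scaleDr resm_scaleDl.
Lemma resm_scaleE (a : R) (x : resm N) : a *: x = phi a *: (x : N).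
Proof. by []. Qed.
End Module.

Lemma resm_linear (A B : lmodType S) (f : {linear A -> B}) :
  exists g : {linear resm A -> resm B}, forall x, g x = f x.
Proof. by apply: mklin => a x y; rewrite resm_scaleE linearP. Qed.

Lemma resm_SES (A B C : lmodType S) :
  SES A B C -> SES (resm A) (resm B) (resm C).
Proof.
move=> [i [p [inj_i sp ex]]].
have [j jE] := resm_linear i; have [q qE] := resm_linear p.
exists j, q; split=> [x y|c|y]; first by rewrite !jE => /inj_i.
  by have [b <-] := sp c; exists b; rewrite qE.
rewrite qE; split=> [/ex[x <-]|[x <-]]; first by exists x; rewrite jE.
by rewrite jE; apply/ex; exists x.
Qed.

Lemma resm_fpd :
  (forall P : lmodType S, projective P -> projective (resm P)) ->
  forall N : lmodType S, fpd N -> fpd (resm N).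
Proof.
move=> resP N [m hN]; exists m; elim: m N hN => [|m IH] N /=; first exact: resP.
move=> [K [P [T /resP pP /IH h]]]; exists (resm K), (resm P).
by split=> //; exact: resm_SES.
Qed.

End Restriction.
End Restriction.
Import Restriction.

(** * Invariance under ring isomorphism *)

Section RingIso.
Variables (R S : comNzRingType) (phi : {rmorphism R -> S}) (psi : {rmorphism S -> R}).
Hypotheses (phiK : cancel phi psi) (psiK : cancel psi phi).

Lemma iso_proj (P : lmodType S) : projective P -> projective (resm phi P).
Proof.
move=> pP A B g f sg; have [g' g'E] := resm_linear psi g.
have [|f' f'E] := @mklin S P (resm psi B) f.
  by move=> a x y; rewrite -[in LHS](psiK a) -[phi _ *: _]resm_scaleE linearP.
have [|h hE] := pP _ _ g' f'; first by move=> b; have [a <-] := sg b; exists a.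
have [|k kE] := @mklin R (resm phi P) A h.
  by move=> a x y; rewrite linearP /= resm_scaleE phiK.
by exists k => x; rewrite kE -f'E -hE g'E.
Qed.

Lemma iso_EV k (N : lmodType S) (Q : lmodType R) :
  EV k N (resm psi Q) -> EV k (resm phi N) Q.
Proof.
elim: k N => [|k IH] N /=; last first.
  move=> [K [P [T /iso_proj pP /IH h]]].
  by exists (resm phi K), (resm phi P); split=> //; exact: resm_SES.
move=> hN A B i p [inj_i sp ex] u.
have [i' i'E] := resm_linear psi i; have [u' u'E] := resm_linear psi u.
have [|p' p'E] := @mklin S (resm psi B) N p.
  by move=> a x y; rewrite linearP resm_scaleE psiK.
have T : ses i' p'.
  split=> [x y|c|y]; first by rewrite !i'E => /inj_i.
    by have [b <-] := sp c; exists b; rewrite p'E.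
  rewrite p'E; split=> [/ex[x <-]|[x <-]]; first by exists x; rewrite i'E.
  by rewrite i'E; apply/ex; exists x.
have [v vE] := hN _ _ _ _ T u'.
have [|w wE] := @mklin R B Q v; last by exists w => a; rewrite wE -i'E vE u'E.
move=> a x y; rewrite -[in LHS](phiK a) -[psi _ *: _]/(phi a *: (x : resm psi B)).
by rewrite linearP resm_scaleE phiK.
Qed.

(** An isomorphism is an exact sequence with zero cokernel, so closure under extensions applies. *)
Lemma EV_iso k (M N Q : lmodType R) (f : {linear M -> N}) :
  injective f -> (forall n, exists m, f m = n) -> EV k M Q -> EV k N Q.
Proof.
move=> inj_f sf; pose Z : lmodType R := 'rV[R]_0.
have pZ : projective Z.
  move=> A B g h _; exists \0 => x /=.
  by rewrite [x]thinmx0 !linear0.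
move=> hM; apply: EV_ext _ hM (EV_proj k Q pZ).
exists f, \0; split=> [//|z|y]; first by exists 0; rewrite [z]thinmx0 [LHS]thinmx0.
by split=> // _; exact: sf.
Qed.

End RingIso.

(** Carries (a) and (b) across, not complexes. Restricting along [psi] and then [phi] returns [M] up
    to the identity map, which [EV_iso] absorbs. *)
Lemma iso_Gdim_le (R S : comNzRingType) (phi : {rmorphism R -> S})
    (psi : {rmorphism S -> R}) n :
  cancel phi psi -> cancel psi phi -> Gdim_le S n -> Gdim_le R n.
Proof.
move=> phiK psiK h; have hull := Gdim_le_hull h; have ev := Gdim_le_EV h.
apply: Gdim_leP => [M|M Q pQ].
  have [H [_ [[i [_ [inj_i _ _]]] fH _]]] := hull (resm psi M).
  have [|j jE] := @mklin R M (resm phi H) i.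
    move=> a x y; rewrite -[in LHS](phiK a) -[psi _ *: _]/(phi a *: (x : resm psi M)).
    by rewrite linearP.
  exists (resm phi H), j; split; first by move=> x y; rewrite !jE => /inj_i.
  by apply: resm_fpd fH => P; exact: iso_proj.
have [|f fE] := @mklin R (resm phi (resm psi M)) M id.
  by move=> a x y; rewrite !resm_scaleE phiK.
apply: (EV_iso (f := f)).
- by move=> x y; rewrite !fE.
- by move=> m; exists m; rewrite fE.
- apply: (iso_EV phiK psiK); apply: ev; exact: iso_proj.
Qed.

(** * Modules over a polynomial ring *)

Module PolyModule.
Section PolyModule.
Variable R : comNzRingType.

(* The {poly R}-module structure on V in which 'X acts as theta. *)
Definition polymod (V : lmodType R) (theta : {linear V -> V}) : Type := V.

Section Def.
Variables (V : lmodType R) (theta : {linear V -> V}).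
Local Notation W := (polymod theta).
HB.instance Definition _ := GRing.Zmodule.on W.

Definition polymod_scale (p : {poly R}) (x : W) : W :=
  \sum_(i < size p) p`_i *: iter i theta (x : V).

Lemma polymod_scaleEw n (p : {poly R}) (x : W) : (size p <= n)%N ->
  polymod_scale p x = \sum_(i < n) p`_i *: iter i theta (x : V).
Proof.
move=> pn; rewrite /polymod_scale.
rewrite (big_ord_widen n (fun i => p`_i *: iter i theta (x : V)) pn) big_mkcond /=.
by apply: eq_bigr => i _; case: ltnP => // /(nth_default 0) ->; rewrite scale0r.
Qed.

Lemma polymod_scaleDl (x : W) : {morph polymod_scale^~ x : p q / p + q}.
Proof.
move=> p q; pose n := maxn (size p) (size q).
rewrite !(@polymod_scaleEw n) ?leq_maxl ?leq_maxr ?size_polyD //.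
by rewrite -big_split /=; apply: eq_bigr => i _; rewrite coefD scalerDl.
Qed.

Lemma polymod_scaleDr : right_distributive polymod_scale +%R.
Proof.
move=> p x y; rewrite /polymod_scale -big_split /=; apply: eq_bigr => i _.
rewrite -scalerDr; congr (_ *: _).
by elim: (i : nat) => [//|j IH] /=; rewrite IH linearD.
Qed.

Lemma polymod_scaleC c (x : W) : polymod_scale c%:P x = c *: (x : V).
Proof.
by rewrite (@polymod_scaleEw 1) ?size_polyC_leq1 // big_ord1 coefC.
Qed.

Lemma polymod_scaleCM c p (x : W) :
  polymod_scale (c%:P * p) x = c *: (polymod_scale p x : V).
Proof.
rewrite (@polymod_scaleEw (size p)); last first.
  by rewrite mul_polyC size_scale_leq.
by rewrite scaler_sumr; apply: eq_bigr => i _; rewrite coefCM scalerA.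
Qed.

Lemma polymod_scaleXM p (x : W) : polymod_scale ('X * p) x = theta (polymod_scale p x).
Proof.
rewrite (@polymod_scaleEw (size p).+1); last first.
  have [->|p0] := eqVneq p 0; first by rewrite mulr0 size_poly0.
  by rewrite mulrC size_mulX.
rewrite big_ord_recl coefXM eqxx scale0r add0r linear_sum /=.
by apply: eq_bigr => i _; rewrite coefXM linearZ.
Qed.

Lemma polymod_scaleA p q (x : W) :
  polymod_scale p (polymod_scale q x) = polymod_scale (p * q) x.
Proof.
elim/poly_ind: p => [|p c IH].
  by rewrite mul0r /polymod_scale size_poly0 !big_ord0.
rewrite mulrDl !polymod_scaleDl [p * 'X]mulrC -mulrA !polymod_scaleXM IH.
by rewrite polymod_scaleC polymod_scaleCM.
Qed.

Lemma polymod_scale1 : left_id 1 polymod_scale.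
Proof. by move=> x; rewrite -[1]/(1%:P) polymod_scaleC scale1r. Qed.

HB.instance Definition _ := GRing.Zmodule_isLmodule.Build {poly R} W
  polymod_scaleA polymod_scale1 polymod_scaleDr polymod_scaleDl.

Lemma polymodC c (x : W) : c%:P *: x = c *: (x : V).
Proof. exact: polymod_scaleC. Qed.

Lemma polymodX (x : W) : 'X *: x = theta x.
Proof. by rewrite -['X]mulr1 [LHS]polymod_scaleXM polymod_scale1. Qed.
End Def.

Lemma poly_linear (A B : lmodType {poly R}) (f : A -> B) :
  (forall x y, f (x + y) = f x + f y) -> (forall c x, f (c%:P *: x) = c%:P *: f x) ->
  (forall x, f ('X *: x) = 'X *: f x) -> exists g : {linear A -> B}, g =1 f.
Proof.
move=> fD fC fX; apply: mklin => p x y; rewrite fD; congr (_ + _).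
elim/poly_ind: p x => [|p c IH] x; last first.
  by rewrite !scalerDl fD fC -!scalerA IH fX.
by have := fC 0 x; rewrite !scale0r.
Qed.

Definition polyC_morph : {rmorphism R -> {poly R}} := @polyC R.
Local Notation res := (resm polyC_morph).

Implicit Types A B C K M N P Q : lmodType R.

Lemma shift_ex M : exists h : {linear dsum nat M -> dsum nat M},
  forall i x, h (dinj i x) = dinj i.+1 x.
Proof. exact: dsum_out. Qed.

Definition shift M := sval (cid (shift_ex M)).

(* M[X], with the element m X^i represented by dinj i m. *)
Definition polyx M : lmodType {poly R} := polymod (shift M).

Definition mono M i : M -> polyx M := dinj i.
Definition coefx M i : polyx M -> M := dcoef i.
Arguments mono [M] i x.
Arguments coefx [M] i g.

Lemma mulX_mono M i (x : M) : 'X *: mono i x = mono i.+1 x.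
Proof. by rewrite polymodX /shift; case: cid. Qed.

Lemma polyxC M c (g : polyx M) : c%:P *: g = c *: (g : dsum nat M).
Proof. exact: polymodC. Qed.

Lemma polyx_ind M (T : polyx M -> Prop) :
  T 0 -> (forall g h, T g -> T h -> T (g + h)) -> (forall i x, T (mono i x)) ->
  forall g, T g.
Proof. exact: dsum_ind. Qed.

Lemma polyx_ext M (g h : polyx M) : (forall i, coefx i g = coefx i h) -> g = h.
Proof. exact: dsum_ext. Qed.

Lemma monoD M i (x y : M) : mono i (x + y) = mono i x + mono i y.
Proof. exact: (linearD (dinj i)). Qed.

Lemma mono0 M i : mono i 0 = 0 :> polyx M.
Proof. exact: (linear0 (dinj i)). Qed.

Lemma monoZ M i c (x : M) : mono i (c *: x) = c%:P *: mono i x.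
Proof. by rewrite polyxC; exact: (linearZZ (dinj i)). Qed.

Lemma coefxD M i (g h : polyx M) : coefx i (g + h) = coefx i g + coefx i h.
Proof. exact: (linearD (dcoef i)). Qed.

Lemma coefx0 M i : coefx i (0 : polyx M) = 0.
Proof. exact: (linear0 (dcoef i)). Qed.

Lemma coefxN M i (g : polyx M) : coefx i (- g) = - coefx i g.
Proof. exact: (linearN (dcoef i)). Qed.

Lemma coefxC M i c (g : polyx M) : coefx i (c%:P *: g) = c *: coefx i g.
Proof. by rewrite polyxC; exact: (linearZZ (dcoef i)). Qed.

Lemma coefx_mono M i j (x : M) : coefx j (mono i x) = x *+ (i == j).
Proof. exact: dcoef_inj. Qed.

Lemma coefx_mono0 M (x : M) : coefx 0 (mono 0 x) = x.
Proof. by rewrite coefx_mono. Qed.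

Lemma coefx_mulX0 M (g : polyx M) : coefx 0 ('X *: g) = 0.
Proof.
elim/polyx_ind: g => [|g h IHg IHh|i x]; first by rewrite scaler0 coefx0.
  by rewrite scalerDr coefxD IHg IHh addr0.
by rewrite mulX_mono coefx_mono.
Qed.

Lemma coefx_mulXS M i (g : polyx M) : coefx i.+1 ('X *: g) = coefx i g.
Proof.
elim/polyx_ind: g => [|g h IHg IHh|j x]; first by rewrite scaler0 !coefx0.
  by rewrite scalerDr !coefxD IHg IHh.
by rewrite mulX_mono !coefx_mono eqSS.
Qed.

Lemma mulX_inj M (g h : polyx M) : 'X *: g = 'X *: h -> g = h.
Proof.
move=> e; apply: polyx_ext => i.
have := congr1 (@coefx M i.+1) e.
by rewrite !coefx_mulXS.
Qed.

Lemma polyx_split M (g : polyx M) : exists h, g = mono 0 (coefx 0 g) + 'X *: h.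
Proof.
elim/polyx_ind: g => [|g g' [h hE] [h' hE']|[|i] x].
- by exists 0; rewrite coefx0 mono0 scaler0 addr0.
- by exists (h + h'); rewrite coefxD monoD scalerDr addrACA -hE -hE'.
- by exists 0; rewrite coefx_mono0 scaler0 addr0.
- by exists (mono i x); rewrite coefx_mono mono0 add0r mulX_mono.
Qed.

Lemma polyx_bound M (g : polyx M) : exists n, forall i, (n <= i)%N -> coefx i g = 0.
Proof.
have [s hs] := dsum_bound g; exists (\max_(t <- s) t).+1 => i hi; apply: hs.
apply/negP => /leq_bigmax_seq /(_ isT) h; move: (leq_trans hi (h id)).
by rewrite ltnn.
Qed.

Lemma polyx_make M (x : nat -> M) n :
  (forall i, (n <= i)%N -> x i = 0) -> exists g : polyx M, forall i, coefx i g = x i.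
Proof.
elim: n x => [|n IH] x hx; first by exists 0 => i; rewrite coefx0 hx.
have [|g gE] := IH (x \o S); first by move=> i hi; apply: hx.
exists (mono 0 (x 0%N) + 'X *: g) => -[|i].
  by rewrite coefxD coefx_mono0 coefx_mulX0 addr0.
by rewrite coefxD coefx_mono coefx_mulXS gE add0r.
Qed.

(** Extension of scalars is left adjoint to restriction: m X^i goes to X^i u(m). *)
Lemma polyx_out M (N : lmodType {poly R}) (u : {linear M -> res N}) :
  exists h : {linear polyx M -> N}, forall x, h (mono 0 x) = u x.
Proof.
have [h hE] : exists h : {linear dsum nat M -> res N},
    forall i x, h (dinj i x) = 'X^i *: (u x : N).
  have ex i : exists v : {linear M -> res N}, forall x, v x = 'X^i *: (u x : N).
    apply: mklin => a x y; rewrite linearP scalerDr; congr (_ + _).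
    by rewrite !resm_scaleE !scalerA mulrC.
  have [h hE] := dsum_out (fun i => sval (cid (ex i))).
  by exists h => i x; rewrite hE; case: cid.
have [||| g gE] := @poly_linear (polyx M) N h.
- by move=> x y; rewrite linearD.
- by move=> c x; rewrite polyxC linearZ.
- elim/polyx_ind => [|x y IHx IHy|i x].
  + by rewrite scaler0 linear0 [RHS]scaler0.
  + by rewrite scalerDr !linearD IHx IHy.
  + by rewrite mulX_mono !hE scalerA -exprS.
by exists g => x; rewrite gE hE expr0 scale1r.
Qed.

Lemma polyx_eq M (N : lmodType {poly R}) (f g : {linear polyx M -> N}) :
  (forall x, f (mono 0 x) = g (mono 0 x)) -> f =1 g.
Proof.
move=> fg; elim/polyx_ind => [|x y IHx IHy|i x]; first by rewrite !linear0.
  by rewrite !linearD IHx IHy.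
elim: i => [//|i IH]; by rewrite -mulX_mono !linearZ IH.
Qed.

Lemma mono_linear M (i : nat) : exists h : {linear M -> res (polyx M)},
  forall x, h x = mono i x.
Proof. by apply: mklin => a x y; rewrite monoD monoZ. Qed.

Lemma polyx_map M N (f : {linear M -> N}) : exists h : {linear polyx M -> polyx N},
  (forall x, h (mono 0 x) = mono 0 (f x)) /\
  forall i g, coefx i (h g) = f (coefx i g).
Proof.
have [m mE] := mono_linear N 0.
have [h hE] := polyx_out (m \o f); exists h.
have h0 x : h (mono 0 x) = mono 0 (f x) by rewrite hE /= mE.
split=> // i g; elim/polyx_ind: g i => [|x y IHx IHy|j x] i.
- by rewrite linear0 !coefx0 linear0.
- by rewrite linearD !coefxD IHx IHy linearD.
- elim: j i => [|j IH] i; first by rewrite h0 !coefx_mono raddfMn.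
  rewrite -mulX_mono linearZ /=; case: i => [|i].
    by rewrite !coefx_mulX0 linear0.
  by rewrite !coefx_mulXS IH.
Qed.

Lemma polyx_ses A B C (i : {linear A -> B}) (p : {linear B -> C})
    (i' : {linear polyx A -> polyx B}) (p' : {linear polyx B -> polyx C}) :
  (forall k g, coefx k (i' g) = i (coefx k g)) ->
  (forall k g, coefx k (p' g) = p (coefx k g)) -> ses i p -> ses i' p'.
Proof.
move=> iE pE S; have [inj_i sp _] := S; split=> [x y xy|c|y].
- by apply: polyx_ext => k; apply: inj_i; rewrite -!iE xy.
- have [n hn] := polyx_bound c; have [s sK] := surj_section sp.
  (* The section need not send 0 to 0, so preimages are cut off beyond [n] to keep the support
     finite. *)
  have [|b bE] := @polyx_make B (fun k => if (n <= k)%N then 0 else s (coefx k c)) n.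
    by move=> k ->.
  exists b; apply: polyx_ext => k; rewrite pE bE.
  by case: leqP => [/hn ->|_]; rewrite ?linear0 ?sK.
- split=> [py|[x <-]]; last first.
    by apply: polyx_ext => k; rewrite pE iE (ses0 S) coefx0.
  have ex k : exists a, i a = coefx k y.
    by apply: (ses_lift S); rewrite -pE py coefx0.
  pose a k := sval (cid (ex k)).
  have aE k : i (a k) = coefx k y by rewrite /a; case: cid.
  have [n hn] := polyx_bound y.
  have [|x xE] := @polyx_make A a n.
    by move=> k /hn yk; apply: inj_i; rewrite aE yk linear0.
  by exists x; apply: polyx_ext => k; rewrite iE xE aE.
Qed.

Lemma polyx_SES A B C : SES A B C -> SES (polyx A) (polyx B) (polyx C).
Proof.
move=> [i [p S]]; have [i' [_ iE]] := polyx_map i; have [p' [_ pE]] := polyx_map p.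
by exists i', p'; exact: polyx_ses iE pE S.
Qed.

Lemma polyx_proj P : projective P -> projective (polyx P).
Proof.
move=> pP A B g f sg; have [g' gE] := resm_linear polyC_morph g.
have [f' fE] := resm_linear polyC_morph f; have [m mE] := mono_linear P 0.
have [|h hE] := pP _ _ g' (f' \o m); first by move=> b; have [a <-] := sg b; exists a.
have [k kE] := polyx_out h; exists k; apply: (@polyx_eq _ _ (g \o k)) => x /=.
by rewrite kE -gE hE /= mE fE.
Qed.

Lemma polyx_fpd M : fpd M -> fpd (polyx M).
Proof.
move=> [m h]; exists m; elim: m M h => [|m IH] M /=; first exact: polyx_proj.
move=> [K [P [T /polyx_proj pP /IH h]]]; exists (polyx K), (polyx P).
by split=> //; exact: polyx_SES.
Qed.

(** Q is a retract of some F[X] with F projective over R, and over R this F[X] is a direct sum of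
    copies of F. *)
Lemma res_proj (Q : lmodType {poly R}) : projective Q -> projective (res Q).
Proof.
move=> pQ; have [F [p [pF sp]]] := proj_cover (res Q).
have [q qE] := polyx_out p.
have [|s sE] := pQ _ _ q idfun; first by move=> b; have [x <-] := sp b; exists (mono 0 x).
have [|s' s'E] := @mklin R (res Q) (dsum nat F) s.
  by move=> a x y; rewrite resm_scaleE linearP polyxC.
have [|q' q'E] := @mklin R (dsum nat F) (res Q) q.
  by move=> a x y; rewrite resm_scaleE -linearP polyxC.
apply: (proj_retract (s := s') (r := q')); last exact: proj_dsum.
by move=> x; rewrite q'E s'E sE.
Qed.

(** By the adjunction, Ext over R[X] from M[X] to N is Ext over R from M to the restriction of N. *)
Lemma polyx_EV k M (N : lmodType {poly R}) : EV k M (res N) -> EV k (polyx M) N.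
Proof.
elim: k M => [|k IH] M /=; last first.
  move=> [K [P [T /polyx_proj pP /IH h]]]; exists (polyx K), (polyx P).
  by split=> //; exact: polyx_SES.
move=> hM; have [K [P [[i [p S]] pP]]] := pres_ex M.
have [i' [i0 iE]] := polyx_map i; have [p' [_ pE]] := polyx_map p.
apply: E1_pres (polyx_ses iE pE S) (polyx_proj pP) _ => u.
have [u' u'E] := resm_linear polyC_morph u; have [m mE] := mono_linear K 0.
have [v vE] := hM _ _ _ _ S (u' \o m); have [w wE] := polyx_out v.
exists w; apply: (@polyx_eq _ _ (w \o i')) => x /=.
by rewrite i0 wE vE /= mE u'E.
Qed.

(* The resolution 0 -> N[X] -> N[X] -> N -> 0 of a {poly R}-module N, whose
   first map is X - theta, with theta induced by the action of X on N. *)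
Lemma char_SES (N : lmodType {poly R}) : SES (polyx (res N)) (polyx (res N)) N.
Proof.
have [p p0] := @polyx_out (res N) N idfun.
have [theta tE] : exists theta : {linear res N -> res N},
    forall x, theta x = 'X *: (x : N).
  apply: mklin => a x y; rewrite scalerDr; congr (_ + _).
  by rewrite !resm_scaleE !scalerA mulrC.
have [u uE] : exists u : {linear res N -> res (polyx (res N))},
    forall x, u x = mono 1 x - mono 0 (theta x).
  apply: mklin => a x y.
  by rewrite linearP !monoD !monoZ resm_scaleE scalerBr opprD addrACA.
have [k k0] := polyx_out u.
have kS i x : k (mono i x) = mono i.+1 x - mono i (theta x).
  elim: i => [|i IH]; first by rewrite k0 uE.
  by rewrite -mulX_mono linearZ /= IH scalerBr !mulX_mono.
have pS i x : p (mono i x) = 'X^i *: (x : N).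
  elim: i => [|i IH]; first by rewrite p0 expr0 scale1r.
  by rewrite -mulX_mono linearZ /= IH scalerA -exprS.
have ck i g : coefx i.+1 (k g) = coefx i g - theta (coefx i.+1 g).
  elim/polyx_ind: g => [|x y IHx IHy|j x].
  - by rewrite linear0 !coefx0 linear0 subr0.
  - by rewrite linearD !coefxD IHx IHy linearD opprD addrACA.
  - rewrite kS coefxD coefxN !coefx_mono eqSS.
    by case: (j == i.+1); rewrite ?mulr1n ?mulr0n ?linear0.
exists k, p; split=> [|x|g].
- apply: inj_ker => g kg.
  (* In the kernel each coefficient is determined by the next, so vanishing propagates down from
     beyond the degree. *)
  have gS i : coefx i g = theta (coefx i.+1 g).
    by apply/eqP; rewrite -subr_eq0 -ck kg coefx0.
  have [n hn] := polyx_bound g.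
  have gn j : forall i, (n - j <= i)%N -> coefx i g = 0.
    elim: j => [|j IH] i hi; first by rewrite hn // -[n]subn0.
    by rewrite gS IH ?linear0 //; move: hi; rewrite subnS; case: (n - j)%N.
  by apply: polyx_ext => i; rewrite (gn n) ?subnn // coefx0.
- by exists (mono 0 (x : res N)); rewrite p0.
- split=> [pg|[x <-]]; last first.
    elim/polyx_ind: x => [|x y IHx IHy|i x]; first by rewrite !linear0.
      by rewrite !linearD IHx IHy addr0.
    by rewrite kS linearB !pS tE scalerA -exprSr subrr.
  suff [h hE] : exists h, k h = (g : polyx (res N)) - mono 0 (p g : res N).
    by exists h; rewrite hE pg mono0 subr0.
  elim/polyx_ind: g {pg} => [|x y [hx hxE] [hy hyE]|i x].
  + by exists 0; rewrite !linear0 mono0 subr0.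
  + by exists (hx + hy); rewrite !linearD hxE hyE monoD opprD addrACA.
  + elim: i x => [|i IH] x; first by exists 0; rewrite linear0 p0 subrr.
    have [h hE] := IH (theta x); exists (mono i x + h).
    by rewrite linearD hE kS !pS tE scalerA -exprSr addrA subrK.
Qed.

End PolyModule.
End PolyModule.
Import PolyModule.
Arguments mono {R M} i x.
Arguments coefx {R M} i g.

(** Extend A -> B -> HB to [f] on HA, and pair it with HA -> GA -> P. The second component vanishes
    only on A, where [f] is injective; so HA embeds in HB x P, and M = B/A embeds in the
    cokernel. *)
Lemma quotient_hull (R : comNzRingType)
    (A B M HA GA HB GB P N : lmodType R) :
  SES A B M -> SES A HA GA -> SES B HB GB -> SES GA P N ->
  projective P -> fpd HA -> fpd HB -> E1 GA HB ->
  exists (H : lmodType R) (i : {linear M -> H}), injective i /\ fpd H.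
Proof.
move=> [i [p S]] [ja [qa SA]] [jb [_ [inj_jb _ _]]] [c [_ [inj_c _ _]]] pP fA fB ext.
have [inj_ja _ _] := SA; have [_ sp _] := S.
have [f fE] := ext _ _ _ _ SA (jb \o i).
have [h hE] := prod_in f (c \o qa).
(* The image of [h] meets B only in A. This gives injectivity of [h], with b = 0, and later that of
   M into the cokernel. *)
have hker b x : h x = (jb b, 0) -> exists a, i a = b /\ ja a = x.
  rewrite hE => -[fx cqx].
  have [|a aE] := ses_lift SA (y := x); first by apply: inj_c; rewrite cqx linear0.
  by exists a; split=> //; apply: inj_jb; rewrite -fx -aE fE.
have inj_h : injective h.
  apply: inj_ker => x hx; have [|a [ia <-]] := hker 0 x; first by rewrite hx linear0.
  by have [inj_i _ _] := S; rewrite (inj_i a 0) ?linear0.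
have [C [r T]] := ses_coker inj_h.
have [_ [_ [l [_ [_ _ lE _]]]]] := prod_lin HB P.
have [|u uE] := factor_surj (u := r \o (l \o jb)) sp.
  move=> b /(ses_lift S)[a <-] /=; rewrite lE.
  suff -> : (jb (i a), 0) = h (ja a) by exact: ses0 T _.
  by rewrite hE /= fE (ses0 SA) linear0.
exists C, u; split; last first.
  apply: (@fpd_coker _ HA (HB * P)%type); first by exists h, r.
    exact: fA.
  apply: fpd_ext (SES_prod HB P) fB _; exact: fpd_proj.
apply: inj_ker => m; have [b <-] := sp m; rewrite uE /= lE => /(ses_lift T)[x /hker].
by move=> [a [<- _]]; exact: ses0 S _.
Qed.

(** * Passing the bound between R and R[X] *)

Section PolyGdim.
Variable R : comNzRingType.
Implicit Types A B C K M P Q : lmodType R.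
Local Notation res := (resm (polyC_morph R)).

Lemma poly_Gdim_le n : Gdim_le R n -> Gdim_le {poly R} n.+1.
Proof.
move=> h; have hull := Gdim_le_hull h; have ev := Gdim_le_EV h.
apply: Gdim_leP => [N|N Q pQ].
  have [H [G [S fH gG]]] := hull (res N); have [P [N' [T pP _]]] := GP_right gG.
  have perpG : perp (polyx G).
    by move=> k Q pQ; apply: polyx_EV; apply: GP_perp gG _ _ (res_proj pQ).
  apply: (quotient_hull (char_SES N) (polyx_SES S) (polyx_SES S) (polyx_SES T)).
  - exact: polyx_proj.
  - exact: polyx_fpd.
  - exact: polyx_fpd.
  - exact: perp_fpd perpG (polyx_fpd fH) 0%N.
have pQ' := res_proj pQ.
(* Ext^(n+2)(N, Q) sits between Ext^(n+1) and Ext^(n+2) of N[X]; both are Ext groups over R, and the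
   second is shifted down by one syzygy. *)
apply: EV_coker (char_SES N) _ _; apply: polyx_EV; first exact: ev.
by have [K [P [S pP]]] := pres_ex (res N); apply/(EV_pres _ _ S pP)/ev.
Qed.

Definition trivx M : lmodType {poly R} := polymod (\0 : {linear M -> M}).

Lemma trivxC M c (x : trivx M) : c%:P *: x = c *: (x : M).
Proof. exact: polymodC. Qed.

Lemma trivxX M (x : trivx M) : 'X *: x = 0.
Proof. exact: polymodX. Qed.

Lemma trivx_SES A B C : SES A B C -> SES (trivx A) (trivx B) (trivx C).
Proof.
have lin (M N : lmodType R) (f : {linear M -> N}) :
    exists g : {linear trivx M -> trivx N}, forall x, g x = f x.
  apply: poly_linear => [x y|c x|x]; first exact: (linearD f).
    by rewrite !trivxC; exact: (linearZZ f).
  by rewrite !trivxX; exact: (linear0 f).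
move=> [i [p [inj_i sp ex]]]; have [j jE] := lin _ _ i; have [q qE] := lin _ _ p.
exists j, q; split=> [x y|c|y]; first by rewrite !jE => /inj_i.
  by have [b <-] := sp c; exists b; rewrite qE.
rewrite qE; split=> [/ex[x <-]|[x <-]]; first by exists x; rewrite jE.
by rewrite jE; apply/ex; exists x.
Qed.

Lemma trivx_out M P (p : {linear P -> M}) :
  exists f : {linear polyx P -> trivx M}, forall g, f g = p (coefx 0 g).
Proof.
apply: poly_linear => [x y|c x|x]; first by rewrite coefxD linearD.
  by rewrite coefxC linearZZ trivxC.
by rewrite coefx_mulX0 trivxX linear0.
Qed.

Lemma mulX_linear (N : lmodType {poly R}) :
  exists f : {linear N -> N}, forall x, f x = 'X *: x.
Proof. by apply: mklin => a x y; rewrite scalerDr !scalerA mulrC. Qed.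

(* The core of Rees' change of rings
   Ext^(k+1)_R(M, Q) = Ext^(k+2)_R[X](M, Q[X]) in degree k = 0.  With
   0 -> L -> P -> M -> 0, the first syzygy Z of M over R[X] consists of the
   g in P[X] with constant term in L, so that 0 -> L[X] -> L[X] + P[X] -> Z -> 0. *)
Lemma trivx_E1 M Q : EV 1 (trivx M) (polyx Q) -> E1 M Q.
Proof.
have [L [P [[i [p S]] pP]]] := pres_ex M; have [inj_i sp _] := S.
have [f fE] := trivx_out p.
have sf m : exists g, f g = m.
  by have [x <-] := sp m; exists (mono 0 x); rewrite fE coefx_mono0.
have [Z [z T]] := ses_ker sf; have [inj_z _ _] := T.
have SZ : SES Z (polyx P) (trivx M) by exists z, f.
move=> /(EV_pres _ _ SZ (polyx_proj pP)) extZ.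
apply: (E1_pres S pP) => u.
have [I [I0 IE]] := polyx_map i; have [U [U0 _]] := polyx_map u.
have [X XE] := mulX_linear (polyx P).
have [b bE] := prod_out I X.
have [|b' b'E] := factor_inj (u := b) inj_z.
  move=> [g h]; apply: (ses_lift T); rewrite fE bE /= XE coefxD IE coefx_mulX0 addr0.
  exact: (ses0 S (coefx 0 g)).
have [a aE] : exists a : {linear polyx L -> (polyx L * polyx P)%type},
    forall g, a g = (- ('X *: g), I g).
  have [XL XLE] := mulX_linear (polyx L).
  by have [a aE] := prod_in (\- XL) I; exists a => g; rewrite aE /= XLE.
have ab : ses a b'.
  split=> [x y|x|[g h]].
  - by rewrite !aE => /(congr1 fst)/oppr_inj/mulX_inj.
  - have [h hE] := polyx_split (z x).
    have [|l lE] := ses_lift S (y := coefx 0 (z x)).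
      by have := ses0 T x; rewrite fE.
    by exists (mono 0 l, h); apply: inj_z; rewrite b'E bE /= I0 XE hE lE hE.
  - split=> [b0|[x]].
      have : z (b' (g, h)) = 0 by rewrite b0 linear0.
      rewrite b'E bE /= XE => e; have [g' g'E] := polyx_split g.
      have g0 : coefx 0 g = 0.
        apply: inj_i; rewrite -IE linear0; move/(congr1 (@coefx _ P 0)): e.
        by rewrite coefxD coefx_mulX0 addr0 coefx0.
      rewrite g0 mono0 add0r in g'E; exists (- g').
      rewrite aE scalerN opprK -g'E linearN; congr (_, _).
      apply: mulX_inj; rewrite scalerN -[_ *: I g']linearZ /= -g'E.
      by apply/eqP; rewrite -subr_eq0 -opprD oppr_eq0 e.
    rewrite aE => -[<- <-]; apply: inj_z; rewrite b'E bE /= XE linearN linearZ /=.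
    by rewrite addNr linear0.
(* Extend u[X] along [a]; the wanted map is the constant coefficient of [w] on the constants of
   P[X]. *)
have [w wE] := extZ _ _ _ _ ab U.
have [_ [_ [l [r [_ _ lE rE]]]]] := prod_lin (polyx L) (polyx P).
have [v vE] : exists v : {linear P -> Q}, forall x, v x = coefx 0 (w (r (mono 0 x))).
  apply: mklin => c x y.
  by rewrite monoD monoZ linearP /= linearP coefxD coefxC.
exists v => x; rewrite vE -[RHS](coefx_mono0 (u x)) -U0 -wE aE.
(* The first entry is a multiple of X, so it disappears from the constant coefficient and leaves
   [v (i x)]. *)
have -> : (- ('X *: mono 0 x), I (mono 0 x)) = r (mono 0 (i x)) - 'X *: l (mono 0 x).
  by rewrite rE lE I0; congr (_, _); rewrite /= ?scaler0 ?sub0r ?subr0.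
by rewrite linearB linearZ /= coefxD coefxN coefx_mulX0 subr0.
Qed.

(** Dimension shifting along 0 -> K -> P -> M -> 0 with X acting as zero. Here P is not projective
    over R[X], but [char_SES] gives it projective dimension at most 1, enough for Ext^(k+2). *)
Lemma trivx_EV k M Q : EV k.+1 (trivx M) (polyx Q) -> EV k M Q.
Proof.
elim: k M => [|k IH] M h; first exact: trivx_E1.
have [K [P [S pP]]] := pres_ex M; apply/(EV_pres _ _ S pP)/IH.
apply: EV_ker (trivx_SES S) _ h.
have pP' : projective (res (trivx P)).
  have [|s sE] := @mklin R (res (trivx P)) P id.
    by move=> a x y; rewrite resm_scaleE trivxC.
  have [|r rE] := @mklin R P (res (trivx P)) id.
    by move=> a x y; rewrite resm_scaleE trivxC.
  by apply: (proj_retract (s := s) (r := r)) pP => x; rewrite rE sE.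
by apply: EV_coker (char_SES (trivx P)) _ _; apply/EV_proj/polyx_proj.
Qed.

Lemma Gdim_le_poly n : Gdim_le {poly R} n.+1 -> Gdim_le R n.
Proof.
move=> h; have hull := Gdim_le_hull h; have ev := Gdim_le_EV h.
apply: Gdim_leP => [M|M Q pQ]; last exact/trivx_EV/ev/polyx_proj.
have [H [_ [[i [_ [inj_i _ _]]] fH _]]] := hull (trivx M).
have [|j jE] := @mklin R M (res H) i.
  by move=> a x y; rewrite resm_scaleE -linearP trivxC.
exists (res H), j; split; first by move=> x y; rewrite !jE => /inj_i.
by apply: resm_fpd fH => P; exact: res_proj.
Qed.

(** The bound 0 would make Ext^1 of R[X]/(X) into R[X] vanish, giving a linear [v] with v (X) = 1;
    but v (X) = X v (1) has constant term 0. *)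
Lemma poly_Gdim_gt0 : ~ Gdim_le {poly R} 0.
Proof.
move=> /Gdim_le_EV ev; pose M : lmodType R := R^o.
have [f fE] := @trivx_out M M idfun; have [X XE] := mulX_linear (polyx M).
have S : ses X f.
  split=> [x y|m|g]; first by rewrite !XE => /mulX_inj.
    by exists (mono 0 (m : M)); rewrite fE coefx_mono0.
  rewrite fE /=; split=> [g0|[h <-]]; last by rewrite XE coefx_mulX0.
  by have [h ->] := polyx_split g; exists h; rewrite XE g0 mono0 add0r.
have [v vE] := ev (trivx M) _ (polyx_proj (@proj_regular R)) _ _ _ _ S idfun.
have := vE (mono 0 (1 : M)); rewrite XE linearZ /= => /(congr1 (@coefx _ M 0)).
rewrite coefx_mulX0 coefx_mono0 => /esym/eqP; exact/negP/oner_neq0.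
Qed.

End PolyGdim.

(** * Several indeterminates *)

Section MPolyIso.
Variables (n : nat) (R : comNzRingType).
Local Notation widen := (widen_ord (leqnSn n)).

(** [muni] isolates the last variable, so its inverse evaluates there. The values on constants and X
    determine [psi]. *)
Lemma unmuni_ex : exists psi : {rmorphism {poly {mpoly R[n]}} -> {mpoly R[n.+1]}},
  (forall c, psi c%:P = mwiden c) /\ psi 'X = 'X_ord_max.
Proof.
exists (horner_eval ('X_ord_max) \o map_poly (@mwiden n R)).
split=> [c|] /=; first by rewrite map_polyC /horner_eval hornerC.
by rewrite map_polyX /horner_eval hornerX.
Qed.

Lemma muniX m : muni 'X_[R, m] =
  'X_[[multinom m (widen i) | i < n]] *: 'X^(m ord_max) :> {poly {mpoly R[n]}}.
Proof. by rewrite muniE msuppX big_seq1 mcoeffX eqxx scale1r. Qed.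

Section Inverse.
Variable psi : {rmorphism {poly {mpoly R[n]}} -> {mpoly R[n.+1]}}.
Hypotheses (psiC : forall c, psi c%:P = mwiden c) (psiX : psi 'X = 'X_ord_max).

Lemma muniK : cancel (@muni n R) psi.
Proof.
elim/mpolyind => [|c m p _ _ IH]; first by rewrite !rmorph0.
rewrite muniD rmorphD; congr (_ + _); last exact: IH.
rewrite muniZ muniX scalerA -mul_polyC rmorphM rmorphXn psiC psiX.
rewrite mwidenM mwidenC mwidenX -mulrA mul_mpolyC; congr (_ *: _).
rewrite mpolyXn -mpolyXD; congr ('X_[_]); apply/mnmP => i.
rewrite mnmDE mulmnE mnm1E.
have [j->|->] := unliftP ord_max i.
  have -> : lift ord_max j = widen j by apply: val_inj; rewrite /= /bump leqNgt ltn_ord.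
  rewrite mnmwiden_widen mnmE -val_eqE /= gtn_eqF ?addn0 ?mul0n ?muln0 ?addn0 //.
by rewrite mnmwiden_ordmax eqxx mul1n.
Qed.

Lemma psiK : cancel psi (@muni n R).
Proof.
elim/poly_ind => [|p c IH]; first by rewrite !rmorph0.
rewrite rmorphD rmorphM psiC psiX muniD muniM; congr (_ + _).
  congr (_ * _); first exact: IH.
  rewrite muniX mnm1E eqxx expr1 -[RHS]scale1r; congr (_ *: _).
  rewrite -[RHS]mpolyX0; congr ('X_[_]); apply/mnmP => i.
  by rewrite mnmE mnm1E mnm0E -val_eqE /= gtn_eqF.
elim/mpolyind: c => [|a m q _ _ IHq]; first by rewrite !rmorph0.
rewrite mwidenD muniD polyCD; congr (_ + _); last exact: IHq.
rewrite mwidenZ mwidenX muniZ muniX mnmwiden_ordmax expr0 -mul_mpolyC polyCM.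
rewrite -mul_polyC alg_polyC; congr (_ * _%:P); congr ('X_[_]).
by apply/mnmP => i; rewrite mnmE mnmwiden_widen.
Qed.

End Inverse.

Lemma Gdim_le_mpolyS k :
  Gdim_le {mpoly R[n.+1]} k <-> Gdim_le {poly {mpoly R[n]}} k.
Proof.
have [psi [psiC psiX]] := unmuni_ex.
have K := muniK psiC psiX; have K' := psiK psiC psiX.
by split; [exact: iso_Gdim_le K' K | exact: iso_Gdim_le K K'].
Qed.

End MPolyIso.

Lemma Gdim_le_mpoly0 (R : comNzRingType) k : Gdim_le {mpoly R[0]} k <-> Gdim_le R k.
Proof.
have cK : cancel (@mpolyC 0 R) (mcoeff 0%MM) by move=> c; rewrite mcoeffC eqxx mulr1.
have Kc : cancel (mcoeff 0%MM) (@mpolyC 0 R) by move=> p; rewrite -nvar0_mpolyC.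
by split; [exact: iso_Gdim_le cK Kc | exact: iso_Gdim_le Kc cK].
Qed.

(** * From uniform bounds to the extended natural number *)

Lemma least_le (P : nat -> Prop) k :
  enat_le (least P) (Some k) <-> exists2 j, (j <= k)%N & P j.
Proof.
rewrite /least; case: pselect => [exP|nP] /=.
  case: ex_minnP => m /asboolP Pm min; split=> [mk|[j jk Pj]]; first by exists m.
  by apply: leq_trans jk; apply: min; apply/asboolP.
by split=> // -[j _ Pj]; apply: nP; exists j.
Qed.

Lemma eq_least (P Q : nat -> Prop) : (forall k, P k <-> Q k) -> least P = least Q.
Proof. by move=> PQ; congr least; apply/funext => k; apply/propext. Qed.

(** As 0 fails [P], every witness of [P] is a successor; so [P] and [Q] have witnesses together,
    which settles the infinite case. *)
Lemma least_succ (P Q : nat -> Prop) :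
  ~ P 0%N -> (forall k, P k.+1 <-> Q k) -> least P = enat_addn (least Q) 1.
Proof.
move=> P0 PQ; rewrite /least.
case: pselect => [exP|nP]; case: pselect => [exQ|nQ] //=.
- case: ex_minnP => m /asboolP Pm minP; case: ex_minnP => l /asboolP Ql minQ.
  congr Some; apply/eqP; rewrite eqn_leq addn1; apply/andP; split.
    by apply: minP; apply/asboolP/PQ.
  by case: m Pm {minP} => // m /PQ Qm; apply: minQ; apply/asboolP.
- by exfalso; case: exP => -[//|k] /PQ Qk; case: nQ; exists k.
- by exfalso; case: exQ => k /PQ Pk; case: nP; exists k.+1.
Qed.

Lemma G_gldimE (R : comNzRingType) : G_gldim R = least (Gdim_le R).
Proof.
apply: eq_least => k; split=> [h M|h a [M ->]]; last exact/least_le/h.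
by apply/least_le/h; exists M.
Qed.

Theorem theorem2p1 (R : comNzRingType) (n : nat) :
  G_gldim {mpoly R[n]} = enat_addn (G_gldim R) n.
Proof.
elim: n => [|n IH].
  rewrite !G_gldimE (eq_least (@Gdim_le_mpoly0 R)).
  by case: least => //= k; rewrite addn0.
rewrite G_gldimE (eq_least (@Gdim_le_mpolyS n R)).
rewrite (@least_succ _ (Gdim_le {mpoly R[n]})).
- by rewrite -G_gldimE IH; case: (G_gldim R) => //= k; rewrite addn1 addnS.
- exact: poly_Gdim_gt0.
- by move=> k; split; [exact: Gdim_le_poly | exact: poly_Gdim_le].
Qed.
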